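(* Let $(T_1,T_2)$ be a pair of commuting pure contractions on a Hilbert space $\mathcal{H}$ such that $\dim\mathcal{D}_{T_i^*}<\infty$ for $i=1,2$. Then there exists an algebraic distinguished variety $\tilde{\mathcal{V}}$ in $\mathbb{D}^2$ such that $$\|p(T_1,T_2)\|\le\sup_{(z_1,z_2)\in\tilde{\mathcal{V}}}|p(z_1,z_2)|\qquad\text{for all }p\in\mathbb{C}[z_1,z_2].$$
   Context: All Hilbert spaces are complex. A contraction $T$ on $\mathcal{H}$ is pure if $\|T^{*m}h\|\to0$ as $m\to\infty$ for every $h\in\mathcal{H}$; a pair of commuting pure contractions is a commuting pair in which each operator is a pure contraction. For a contraction $T$, $D_{T^*}:=(I-TT^* )^{1/2}$ and $\mathcal{D}_{T^*}:=\overline{D_{T^*}\mathcal{H}}$. $\mathbb{D}$ is the open unit disc and $\mathbb{T}$ the unit circle. An algebraic distinguished variety in $\mathbb{D}^2$ (in the sense of Agler and McCarthy) is a non-empty set of the form $\mathcal{V}=\{(z_1,z_2)\in\mathbb{D}^2:q(z_1,z_2)=0\}$ for some polynomial $q\in\mathbb{C}[z_1,z_2]$, such that $\overline{\mathcal{V}}\cap\partial(\mathbb{D}^2)=\overline{\mathcal{V}}\cap\mathbb{T}^2$. *)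

(* Defs.v *)
From HB Require Import structures.
From mathcomp Require Import all_boot all_order all_algebra.
From mathcomp Require Import sesquilinear polyXY complex.
From mathcomp Require Import all_classical all_reals all_analysis.

Set Implicit Arguments.
Unset Strict Implicit.
Unset Printing Implicit Defensive.

Import Order.TTheory GRing.Theory Num.Theory.
Import numFieldNormedType.Exports.

Local Open Scope classical_set_scope.
Local Open Scope ring_scope.

(* MathComp-Analysis puts the norm topology on [K^o] for every numFieldType
   [K], but does not register it on the concrete carrier [R[i]]. *)
HB.instance Definition _ (R : rcfType) :=
  NormedModule.copy R[i] (R[i] : numFieldType)^o.

(* The norm of a normed module over [R[i]] takes its values in [R[i]] (they
   are nonnegative, hence have zero imaginary part); [rnorm] is the same norm
   with values in [R]. *)
Definition rnorm (R : realType) (V : normedModType R[i]) (x : V) : R :=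
  complex.Re `|x|.

(* A complex Hilbert space is given by a complete normed space [H] over [R[i]]
   together with a positive definite hermitian form [dot], linear in its first
   argument, that induces the norm of [H] (hypothesis [is_inner_product]). *)
Section Operators.
Variables (R : realType) (H : completeNormedModType R[i]).
Variable dot : {dot H for Num.conj}.

Definition is_inner_product : Prop := forall x : H, dot x x = `|x| ^+ 2.

Definition is_adjoint (T S : {linear H -> H}) : Prop :=
  forall x y : H, dot (T x) y = dot x (S y).

(* [get] selects an element of a nonempty set: on a Hilbert space a bounded
   [T] has exactly one adjoint, and a bounded positive operator has exactly
   one bounded positive square root. *)
Definition adjoint (T : {linear H -> H}) : {linear H -> H} :=
  get [set S : {linear H -> H} | is_adjoint T S].

(* On [R[i]], [0 <= z] means that [z] is real and nonnegative. *)
Definition is_positive_sqrt (A : H -> H) (S : {linear H -> H}) : Prop :=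
  [/\ continuous S, forall x : H, 0 <= dot (S x) x
    & forall x : H, S (S x) = A x].

Definition positive_sqrt (A : H -> H) : {linear H -> H} :=
  get [set S : {linear H -> H} | is_positive_sqrt A S].

Definition contraction (T : {linear H -> H}) : Prop :=
  forall x : H, `|T x| <= `|x|.

Definition pure_contraction (T : {linear H -> H}) : Prop :=
  contraction T /\
  forall h : H, (fun m : nat => `|iter m (adjoint T) h|) @ \oo --> (0 : R[i]).

(* D_{T^*} = (I - T T^* )^{1/2} and the closure of its range. *)
Definition defect_operator_adj (T : {linear H -> H}) : {linear H -> H} :=
  positive_sqrt (fun x => x - T (adjoint T x)).

Definition defect_space_adj (T : {linear H -> H}) : set H :=
  closure (range (defect_operator_adj T)).

Definition finite_dimensional (E : set H) : Prop :=
  exists (n : nat) (e : 'I_n -> H),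
    E = [set x | exists c : 'I_n -> R[i], x = \sum_(i < n) c i *: e i].

(* Polynomials in z1, z2 are elements of [{poly {poly R[i]}}] with the
   convention of [polyXY]: [p`_i`_j] is the coefficient of z1^i z2^j, and
   [p.[z1, z2]] is the value at (z1, z2). *)
Definition poly_op (p : {poly {poly R[i]}}) (T1 T2 : {linear H -> H}) :
    H -> H :=
  fun x => \sum_(i < size p) \sum_(j < size p`_i)
             p`_i`_j *: iter i T1 (iter j T2 x).

Definition opnorm (A : H -> H) : \bar R :=
  ereal_sup [set (rnorm (A x))%:E | x in [set x : H | `|x| <= 1]].

End Operators.

Section DistinguishedVarieties.
Variable R : realType.

Definition bidisc : set (R[i] * R[i]) :=
  [set z | `|z.1| < 1 /\ `|z.2| < 1].

Definition torus2 : set (R[i] * R[i]) :=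
  [set z | `|z.1| = 1 /\ `|z.2| = 1].

Definition topological_boundary (X : topologicalType) (A : set X) : set X :=
  closure A `\` interior A.

Definition algebraic_distinguished_variety (V : set (R[i] * R[i])) : Prop :=
  [/\ V !=set0,
      exists q : {poly {poly R[i]}},
        V = [set z | bidisc z /\ q.[z.1, z.2] = 0]
    & closure V `&` topological_boundary bidisc = closure V `&` torus2].

Definition sup_norm_on (V : set (R[i] * R[i])) (p : {poly {poly R[i]}}) :
    \bar R :=
  ereal_sup [set (rnorm (p.[z.1, z.2] : R[i]))%:E | z in V].

End DistinguishedVarieties.

(* Main.v *)
Require Import Defs.
From HB Require Import structures.
From mathcomp Require Import all_boot all_order all_algebra.
From mathcomp Require Import sesquilinear spectral polyXY separable cyclic cyclotomic.
From mathcomp Require Import complex ring lra.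
From mathcomp Require Import all_classical all_reals all_analysis.

(* Let [u] and [v] be the finite linearly independent families with
   [I - T1 T1^* = sum_k <., u_k> u_k] and [I - T2 T2^* = sum_k <., v_k> v_k].
   Expanding [I - T1 T2 T1^* T2^*] in two ways shows that [(u, T1 v)] and
   [(T2 u, v)] have the same frame operator, so a unitary matrix [M] maps the
   first family to the second. Its transfer function
   [Phi z = M11 + z M12 (1 - z M22)^-1 M21] is contractive on the disc and
   unitary on the circle, and [f |-> sum_k f_k(T1) u_k], a contraction from the
   Hardy space, turns multiplication by [Phi] into [T2]. Diagonalizing [Phi] on
   the circle bounds [p(T1, T2)] by the supremum of [|p(z, w)|] over [|z| = 1]
   and [w] in the spectrum of [Phi z]. Purity of [T2] and of [T1] excludes
   unimodular eigenvalues of [M11] and of [M22]; hence the zero set of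
   [det (Phi z - w)] in the bidisc leaves it only through the torus, and these
   boundary points are limits of points of that set. *)

Set Implicit Arguments.
Unset Strict Implicit.
Unset Printing Implicit Defensive.

Import Order.TTheory GRing.Theory Num.Theory.
Import numFieldNormedType.Exports.

Local Open Scope ring_scope.

(** * Unitary matrices and transfer functions *)

Section Dot.
Local Open Scope sesquilinear_scope.
Variable C : numClosedFieldType.
Implicit Types n : nat.
Local Notation "''[' u , v ]" := (dotmx u v) : ring_scope.
Local Notation "''[' u ]" := (dotmx u u) : ring_scope.

(** A function model for [T1] and [T2] would normally call for vector-valued Hardy spaces, power
    series in [T1] and an infinite-dimensional unitary extension. Finite-dimensional defect spaces
    make all of this finite. The two families have the same length [n1 + n2], so the isometry
    between their rows of inner products extends to a unitary matrix of that size. All estimates are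
    made on rows of polynomials, whose Hardy norm is a finite sum obtained by averaging over roots
    of unity. The map from such rows to [H] is contractive because it is adjoint to taking the
    coefficients of [h], and purity of [T1] makes truncated coefficient rows recover [h] without
    increasing the norm. The price is that Phi is rational: denominators are cleared by powers of
    det (1 - z M22), which has no zero in the closed disc and is therefore invertible there up to a
    small polynomial error. As for purity: a unimodular eigenvector of M11 is killed by M12, since M
    preserves norms, and so gives a unimodular eigenvector of [T2]; M22 is handled in the same way
    with [T1]. *)

Lemma dotmxC n (u v : 'rV[C]_n) : '[u, v] = ('[v, u])^*.
Proof. by rewrite hermC expr0 mul1r. Qed.

Lemma dotmx_sum n (u v : 'rV[C]_n) : '[u, v] = \sum_i u 0 i * (v 0 i)^*.
Proof. by rewrite dotmxE mxE; apply: eq_bigr => i _; rewrite !mxE. Qed.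

Lemma dnormmx_sum n (u : 'rV[C]_n) : '[u] = \sum_i `|u 0 i| ^+ 2.
Proof. by rewrite dotmx_sum; apply: eq_bigr => i _; rewrite normCK. Qed.

Lemma dotmx_unitary n m (M : 'M[C]_(n, m)) (u v : 'rV[C]_n) :
  M \is unitarymx -> '[u *m M, v *m M] = '[u, v].
Proof.
move=> /unitarymxP MU; rewrite !dotmxE trmx_mul map_mxM.
by rewrite mulmxA -(mulmxA u) MU mulmx1.
Qed.

Lemma dot_row_mx n1 n2 (a a' : 'rV[C]_n1) (b b' : 'rV[C]_n2) :
  '[row_mx a b, row_mx a' b'] = '[a, a'] + '[b, b'].
Proof. by rewrite !dotmxE tr_row_mx map_col_mx mul_row_col mxE. Qed.

(* A complex reflection along [x - y]: the rank one correction is unitary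
   because [2 Re '[x, x - y] = '[x - y]] when [x] and [y] have equal norms. *)
Lemma unitary_reflection n (x y : 'rV[C]_n) : '[x] = '[y] ->
  exists2 W : 'M[C]_n, W \is unitarymx &
    x *m W = y /\ forall u, '[u, x - y] = 0 -> u *m W = u.
Proof.
move=> xy; have [->|neq] := eqVneq x y.
  exists 1%:M; first by apply/unitarymxP; rewrite trmx1 map_mx1 mulmx1.
  by split=> [|u _]; rewrite mulmx1.
set v := x - y; pose g := '[x, v].
have gE : g + g^* = '[v].
  have -> : '[v] = '[x, v] - '[y, v] by rewrite -linearBl.
  by rewrite /g -dotmxC; congr (_ + _); rewrite /v linearBl linearBr /= opprB xy.
have g0 : g != 0.
  apply: contraNneq neq => g0; move/eqP: gE; rewrite g0 conjC0 addr0 eq_sym.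
  by rewrite dnorm_eq0 subr_eq0.
have actE u : u *m (1%:M - g^-1 *: (v^t* *m v)) = u - (g^-1 * '[u, v]) *: v.
  rewrite mulmxBr mulmx1 -scalemxAr mulmxA (mx11_scalar (u *m v^t*)) -dotmxE.
  by rewrite mul_scalar_mx scalerA.
exists (1%:M - g^-1 *: (v^t* *m v)); last first.
  split=> [|u uv]; rewrite actE; last by rewrite uv mulr0 scale0r subr0.
  by rewrite mulVf // scale1r subKr.
pose Q : 'M[C]_n := v^t* *m v; pose c := g^-1.
have QC : Q^t* = Q by rewrite trmx_mul map_mxM trmxCK.
have QQ : Q *m Q = '[v] *: Q.
  by rewrite mulmxA -(mulmxA _ v) (mx11_scalar (v *m _)) -dotmxE mul_mx_scalar scalemxAl.
have WC : (1%:M - c *: Q)^t* = 1%:M - c^* *: Q.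
  by rewrite linearB /= linearZ /= trmx1 raddfB /= map_mx1 map_mxZ QC.
apply/unitarymxP; rewrite WC mulmxBl mul1mx mulmxBr mulmx1.
rewrite -scalemxAl -scalemxAr QQ !scalerA -addrA -opprD -gE.
rewrite addrCA -scalerBl -scalerDl /c fmorphV /=; set d := (X in X *: _).
suff -> : d = 0 by rewrite scale0r subr0.
have gc0 : g^* != 0 by rewrite conjC_eq0.
by rewrite /d; field; rewrite g0 gc0.
Qed.

(** One reflection per pair is enough. Equality of the Gram matrices makes every vector already in
    place orthogonal to the difference that the next reflection moves, so that reflection fixes
    it. *)
Lemma unitary_transfer n (s : seq ('rV[C]_n * 'rV[C]_n)) :
  {in s &, forall p q, '[p.1, q.1] = '[p.2, q.2]} ->
  exists2 W : 'M[C]_n, W \is unitarymx & {in s, forall p, p.1 *m W = p.2}.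
Proof.
elim: s => [|p s IH] sE.
  exists 1%:M => //; by apply/unitarymxP; rewrite trmx1 map_mx1 mulmx1.
have [|W WU WE] := IH.
  by move=> q r qs rs; apply: sE; rewrite inE ?qs ?rs orbT.
have pp : '[p.1 *m W] = '[p.2] by rewrite dotmx_unitary // sE ?mem_head.
have [W' WU' [W'p W'E]] := unitary_reflection pp.
exists (W *m W'); first exact: mul_unitarymx.
move=> q; rewrite inE mulmxA => /predU1P[->//|qs]; rewrite WE // W'E //.
rewrite linearBr /= -{1}(WE _ qs) dotmx_unitary // sE ?subrr ?mem_head //.
by rewrite inE qs orbT.
Qed.


End Dot.

(** * Parseval's identity on roots of unity *)

Section PolyEval.
Variable C : numClosedFieldType.

Lemma prim_root_exists n : (n > 0)%N -> exists z : C, n.-primitive_root z.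
Proof.
pose p : {poly C} := 'X^n - 1; have [r Dp] := closed_field_poly_normal p.
move=> n_gt0; rewrite (monicP _) ?monicXnsubC // scale1r in Dp.
have rn1 : all n.-unity_root r by apply/allP=> z; rewrite -root_prod_XsubC -Dp.
have sz_r : (n < (size r).+1)%N.
  by rewrite -(size_prod_XsubC r id) -Dp size_XnsubC.
have [|z _ zP] := hasP (has_prim_root n_gt0 rn1 _ sz_r); last by exists z.
by rewrite -separable_prod_XsubC -Dp separable_Xn_sub_1 // pnatr_eq0 -lt0n.
Qed.

Lemma prim_root_norm n (z : C) : n.-primitive_root z -> `|z| = 1.
Proof.
move=> zP; have n_gt0 := prim_order_gt0 zP.
by apply/eqP; rewrite -(@pexpr_eq1 _ _ n) // -normrX (prim_expr_order zP) normr1.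
Qed.

Lemma prim_root_sum n (z : C) (i j : 'I_n) : n.-primitive_root z ->
  \sum_(t < n) (z ^+ t) ^+ i * ((z ^+ t) ^+ j)^* = n%:R *+ (i == j).
Proof.
move=> zP; have zn := prim_root_norm zP.
have z0 : z != 0 by rewrite -normr_gt0 zn.
have zV k : (z ^+ k)^* = (z ^+ k)^-1 by rewrite invC_norm normrX zn expr1n expr1n invr1 mul1r.
pose y := z ^+ i / z ^+ j.
transitivity (\sum_(t < n) y ^+ t).
  apply: eq_bigr => t _; rewrite -!exprM zV /y expr_div_n -!exprM.
  by rewrite (mulnC i) (mulnC j).
have [ij|ij] := eqVneq i j.
  rewrite /y ij divff ?expf_neq0 //; under eq_bigr do rewrite expr1n.
  by rewrite sumr_const card_ord mulr1n.
have y1 : y != 1.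
  rewrite -subr_eq0 -(mulIr_eq0 _ (mulIf (expf_neq0 j z0))) mulrBl divfK ?expf_neq0 //.
  rewrite mul1r subr_eq0 (eq_prim_root_expr zP) !modn_small //.
apply/eqP; rewrite mulr0n -(mulrI_eq0 _ (mulfI (_ : y - 1 != 0))) ?subr_eq0 //.
rewrite -subrX1 /y expr_div_n -!exprM !(mulnC _ n) !exprM (prim_expr_order zP).
by rewrite !expr1n divr1 subrr.
Qed.

(** The squared Hardy space norm of a vector-valued polynomial. *)
Definition polyrow_norm2 n (F : 'rV[{poly C}]_n) : C :=
  \sum_k \sum_(i < size (F 0 k)) `|(F 0 k)`_i| ^+ 2.

Definition polyrow_eval n (z : C) (F : 'rV[{poly C}]_n) : 'rV[C]_n :=
  map_mx (horner_eval z) F.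

(** The size bound keeps the exponents distinct modulo [N], so the discrete Fourier transform
    separates all coefficients. *)
Lemma poly_parseval N (z : C) (g : {poly C}) : N.-primitive_root z -> (size g <= N)%N ->
  \sum_(t < N) `|g.[z ^+ t]| ^+ 2 = N%:R * \sum_(i < size g) `|g`_i| ^+ 2.
Proof.
move=> zP gN; have -> : \sum_(i < size g) `|g`_i| ^+ 2 = \sum_(i < N) `|g`_i| ^+ 2.
  rewrite (big_ord_widen N (fun i => `|g`_i| ^+ 2)) // big_mkcond /=.
  apply: eq_bigr => i _; case: ltnP => // /(nth_default 0)->.
  by rewrite normr0 expr0n.
transitivity (\sum_(t < N) \sum_(j < N) \sum_(i < N)
    (g`_i * (z ^+ t) ^+ i) * (g`_j * (z ^+ t) ^+ j)^*).
  apply: eq_bigr => t _; rewrite normCK (horner_coef_wide _ gN) rmorph_sum mulr_sumr.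
  by apply: eq_bigr => j _; rewrite mulr_suml.
rewrite exchange_big mulr_sumr; apply: eq_bigr => j _ /=; rewrite exchange_big /=.
transitivity (\sum_(i < N) (g`_i * (g`_j)^*) * (N%:R *+ (i == j))).
  apply: eq_bigr => i _; rewrite -(prim_root_sum i j zP) mulr_sumr.
  by apply: eq_bigr => t _; rewrite rmorphM /= mulrACA.
rewrite (bigD1 j) //= eqxx mulr1n mulrC -normCK big1 ?addr0 // => i /negPf->.
by rewrite mulr0n mulr0.
Qed.

Lemma polyrow_parseval n N (z : C) (F : 'rV[{poly C}]_n) : N.-primitive_root z ->
  (forall k, (size (F 0%R k) <= N)%N) ->
  \sum_(t < N) dotmx (polyrow_eval (z ^+ t) F) (polyrow_eval (z ^+ t) F) =
    N%:R * polyrow_norm2 F.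
Proof.
move=> zP FN; under eq_bigr do rewrite dnormmx_sum.
rewrite exchange_big mulr_sumr; apply: eq_bigr => k _ /=.
by rewrite -(poly_parseval zP (FN k)); apply: eq_bigr => t _; rewrite mxE.
Qed.

(* Parseval over roots of unity of order exceeding all degrees. *)
Lemma polyrow_norm2_le n (F G : 'rV[{poly C}]_n) (s : C) :
  (forall w : C, `|w| = 1 ->
     dotmx (polyrow_eval w F) (polyrow_eval w F) <=
     s * dotmx (polyrow_eval w G) (polyrow_eval w G)) ->
  polyrow_norm2 F <= s * polyrow_norm2 G.
Proof.
move=> FG; pose N := (\max_k maxn (size (F 0%R k)) (size (G 0%R k))).+1.
have Nk k : (maxn (size (F 0%R k)) (size (G 0%R k)) <= N)%N.
  by apply: leqW; apply: (leq_bigmax k).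
have [z zP] := @prim_root_exists N isT.
rewrite -(@ler_pM2l _ N%:R) ?ltr0n // mulrCA -!(polyrow_parseval zP); first last.
- by move=> k; apply: leq_trans (Nk k); rewrite leq_maxl.
- by move=> k; apply: leq_trans (Nk k); rewrite leq_maxr.
rewrite mulr_sumr; apply: ler_sum => t _; apply: FG.
by rewrite normrX (prim_root_norm zP) expr1n.
Qed.

End PolyEval.

(** * The transfer function of a unitary matrix, acting on rows from the right *)

Section TransferFunction.
Variables (C : numClosedFieldType) (n1 n2 : nat) (M : 'M[C]_(n1 + n2)).
Local Notation "''[' u ]" := (dotmx u u) : ring_scope.
Local Notation M11 := (ulsubmx M).
Local Notation M12 := (ursubmx M).
Local Notation M21 := (dlsubmx M).
Local Notation M22 := (drsubmx M).
Local Notation "A ^P" := (map_mx (@polyC C) A) (at level 8).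

Definition resolvent (z : C) : 'M[C]_n2 := invmx (1%:M - z *: M22).

Definition transfer (z : C) : 'M[C]_n1 :=
  M11 + z *: (M12 *m resolvent z *m M21).

Definition pencil : 'M[{poly C}]_n2 := 1%:M - 'X *: M22^P.

(** The transfer function times [\det pencil]: the adjugate replaces the inverse, so the entries are
    polynomials and can be evaluated at an operator. *)
Definition transfer_num : 'M[{poly C}]_n1 :=
  \det pencil *: M11^P + 'X *: (M12^P *m \adj pencil *m M21^P).

(* Vanishes at [(z, w)] iff [w] is an eigenvalue of [transfer z], at least when
   [1 - z M22] is invertible; the outer variable is [z]. *)
Definition transfer_curve : {poly {poly C}} :=
  \det (map_mx (map_poly polyC) transfer_num -
        ('X%:P * map_poly polyC (\det pencil))%:M).

Lemma map_polyCmx_eval m n (A : 'M[C]_(m, n)) (z : C) :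
  map_mx (horner_eval z) A^P = A.
Proof. by apply/matrixP => i j; rewrite !mxE /horner_eval hornerC. Qed.

Lemma pencil_eval z : map_mx (horner_eval z) pencil = 1%:M - z *: M22.
Proof.
by rewrite map_mxB map_mx1 map_mxZ map_polyCmx_eval /= horner_evalE hornerX.
Qed.

Lemma det_pencil_eval z : (\det pencil).[z] = \det (1%:M - z *: M22).
Proof. by rewrite -pencil_eval det_map_mx. Qed.

Lemma transfer_num_eval z : 1%:M - z *: M22 \in unitmx ->
  map_mx (horner_eval z) transfer_num = (\det pencil).[z] *: transfer z.
Proof.
move=> zU; rewrite map_mxD !map_mxZ !map_mxM !map_polyCmx_eval map_mx_adj pencil_eval.
rewrite /= !horner_evalE hornerX /transfer scalerDr det_pencil_eval; congr (_ + _).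
rewrite /resolvent /invmx zU -scalemxAr -scalemxAl !scalerA; congr (_ *: _).
by rewrite mulrC divrK -?unitmxE.
Qed.

Lemma transfer_curve_eval z w : 1%:M - z *: M22 \in unitmx ->
  transfer_curve.[z, w] =
    (\det pencil).[z] ^+ n1 * \det (transfer z - w%:M).
Proof.
move=> zU; rewrite -detZ scalerBr -transfer_num_eval // scale_scalar_mx.
rewrite /transfer_curve; move: transfer_num (\det pencil) => N d.
rewrite -[LHS]/(horner_eval w (horner_eval z%:P _)) -!det_map_mx; congr (\det _).
rewrite !map_mxB !map_scalar_mx; congr (_ - _%:M); last first.
  by rewrite /= /horner_eval !hornerE horner_map hornerC mulrC.
by apply/matrixP => i j; rewrite !mxE /= /horner_eval horner_map hornerC.
Qed.

Hypothesis MU : M \is unitarymx.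

Lemma unitary_block_dot (a a' : 'rV[C]_n1) (b b' : 'rV[C]_n2) :
  dotmx (a *m M11 + b *m M21) (a' *m M11 + b' *m M21) +
  dotmx (a *m M12 + b *m M22) (a' *m M12 + b' *m M22) =
  dotmx a a' + dotmx b b'.
Proof. by rewrite -!dot_row_mx -!mul_row_block submxK dotmx_unitary. Qed.

(** Energy balance. The row [b a] solves the feedback equation b = a M12 + z b M22, hence [M] sends
    (a, z b) to (a Phi, b), and unitarity compares the inner products. *)
Lemma transfer_dot (z : C) (a a' : 'rV[C]_n1) : 1%:M - z *: M22 \in unitmx ->
  dotmx a a' - dotmx (a *m transfer z) (a' *m transfer z) =
  (1 - `|z| ^+ 2) * dotmx (a *m M12 *m resolvent z) (a' *m M12 *m resolvent z).
Proof.
move=> zU; pose b (x : 'rV[C]_n1) := x *m M12 *m resolvent z.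
have bE x : x *m M12 + (z *: b x) *m M22 = b x.
  have : b x *m (1%:M - z *: M22) = x *m M12 by rewrite mulmxKV.
  by rewrite mulmxBr mulmx1 -scalemxAr -scalemxAl => <-; rewrite subrK.
have aE x : x *m transfer z = x *m M11 + (z *: b x) *m M21.
  by rewrite mulmxDr -scalemxAr -scalemxAl !mulmxA.
have := unitary_block_dot a a' (z *: b a) (z *: b a'); rewrite !bE -!aE linearZlr /=.
by move=> /(canRL (addrK _)) ->; rewrite normCK; ring.
Qed.

Hypothesis M11_pure : forall (a : 'rV[C]_n1) w, `|w| = 1 -> a *m M11 = w *: a -> a = 0.
Hypothesis M22_pure : forall (b : 'rV[C]_n2) w, `|w| = 1 -> b *m M22 = w *: b -> b = 0.

(** A kernel vector is an eigenvector of M22 for 1/z. Since M22 is a contraction, this eigenvalue of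
    modulus at least 1 is unimodular, which [M22_pure] excludes. *)
Lemma pencil_unit (z : C) : `|z| <= 1 -> 1%:M - z *: M22 \in unitmx.
Proof.
move=> z1; rewrite unitmxE unitfE; apply/negP => /det0P [b b0].
rewrite mulmxBr mulmx1 -scalemxAr => /eqP; rewrite subr_eq0 => /eqP bE.
have z0 : z != 0.
  by apply: contraNneq b0 => z0; rewrite bE z0 scale0r.
have bM : b *m M22 = z^-1 *: b by rewrite {2}bE scalerA mulVf // scale1r.
have le1 : '[b *m M22] <= '[b].
  have := unitary_block_dot 0 0 b b; rewrite !mul0mx !add0r linear0l add0r => <-.
  by rewrite lerDr dnorm_ge0.
have zV : `|z^-1| = 1.
  rewrite normfV; apply/eqP; rewrite invr_eq1 eq_le z1 /=.
  move: le1; rewrite bM dnormZ -[leRHS]mul1r ler_pM2r ?dnorm_gt0 // => le1.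
  by rewrite -invf_le1 ?normr_gt0 // -normfV -(@expr_le1 _ 2).
by rewrite (M22_pure zV bM) eqxx in b0.
Qed.

Lemma det_pencil_neq0 z : `|z| <= 1 -> (\det pencil).[z] != 0.
Proof. by move=> /pencil_unit; rewrite det_pencil_eval unitmxE unitfE. Qed.

Lemma transfer_curve_eq0 z w : `|z| <= 1 ->
  (transfer_curve.[z, w] == 0) = eigenvalue (transfer z) w.
Proof.
move=> z1; rewrite transfer_curve_eval ?pencil_unit // mulf_eq0.
rewrite expf_eq0 (negPf (det_pencil_neq0 z1)) andbF /=.
apply/det0P/eigenvalueP => [[a a0 aE]|[a aE a0]]; exists a => //; apply/eqP.
  by rewrite -subr_eq0 -mul_mx_scalar -mulmxBr aE.
by rewrite mulmxBr mul_mx_scalar subr_eq0 aE.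
Qed.

(** On an eigenvector, [transfer_dot] compares 1 - |w|^2 with 1 - |z|^2. The second part treats the
    degenerate case: when the feedback vanishes, the transfer function acts on [a] as M11. *)
Lemma transfer_eigen_norm z w : `|z| <= 1 -> transfer_curve.[z, w] = 0 ->
  exists2 a : 'rV[C]_n1, a != 0 &
  (1 - `|w| ^+ 2) * '[a] = (1 - `|z| ^+ 2) * '[a *m M12 *m resolvent z] /\
  (a *m M12 *m resolvent z = 0 -> a *m M11 = w *: a).
Proof.
move=> z1 /eqP; rewrite transfer_curve_eq0 // => /eigenvalueP [a aE a0].
exists a => //; split=> [|b0].
  by rewrite -transfer_dot ?pencil_unit // aE dnormZ mulrBl mul1r.
by rewrite -aE mulmxDr -scalemxAr !mulmxA b0 mul0mx scaler0 addr0.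
Qed.

(** The signs in the balance rule out |w| > 1; and |w| = 1 makes the feedback vanish, so that [a] is
    a unimodular eigenvector of M11. *)
Lemma transfer_curve_lt1 z w : `|z| < 1 -> transfer_curve.[z, w] = 0 -> `|w| < 1.
Proof.
move=> z1 /(transfer_eigen_norm (ltW z1)) [a a0 [eqn eig]].
have z2 : 0 < 1 - `|z| ^+ 2 by rewrite subr_gt0 expr_lt1.
have [//|w1|w1] := real_ltgtP (normr_real w) (real1 _).
- have := mulr_ge0 (ltW z2) (dnorm_ge0 (@dotmx C n2) (a *m M12 *m resolvent z)).
  rewrite -eqn pmulr_lge0 ?dnorm_gt0 // subr_ge0 expr_le1 // => /(lt_le_trans w1).
  by rewrite ltxx.
- move: eqn; rewrite w1 expr1n subrr mul0r => /esym/eqP; rewrite mulf_eq0 gt_eqF //=.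
  by rewrite dnorm_eq0 => /eqP/eig/(M11_pure w1) a00; rewrite a00 eqxx in a0.
Qed.

Lemma transfer_curve_norm1 z w : `|z| <= 1 -> transfer_curve.[z, w] = 0 ->
  (`|z| == 1) = (`|w| == 1).
Proof.
move=> z1 /[dup] q0 /(transfer_eigen_norm z1) [a a0 [eqn eig]].
apply/idP/idP => [/eqP zE|/eqP wE].
  move/eqP: eqn; rewrite zE expr1n subrr mul0r mulf_eq0 dnorm_eq0 (negPf a0) orbF.
  by rewrite subr_eq0 eq_sym sqrf_eq1 [_ == -1]gt_eqF ?orbF // (lt_le_trans (ltrN10 _)).
apply: contraT => zn; have := transfer_curve_lt1 _ q0; rewrite lt_neqAle zn z1 wE ltxx.
by move=> /(_ isT).
Qed.

Lemma transfer_unitary z : `|z| = 1 -> transfer z \is unitarymx.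
Proof.
move=> z1; apply/row_unitarymxP => i j; rewrite !rowE.
have zU : 1%:M - z *: M22 \in unitmx by rewrite pencil_unit ?z1.
have := transfer_dot 'e_i 'e_j zU.
rewrite z1 expr1n subrr mul0r => /eqP; rewrite subr_eq0 => /eqP <-.
by rewrite dotmxE trmx_delta map_delta_mx mul_delta_mx_cond mulmxnE mxE !eqxx.
Qed.

Lemma horner2_sum (p : {poly {poly C}}) (z w : C) :
  p.[z, w] = \sum_(i < size p) \sum_(j < size p`_i) p`_i`_j * z ^+ i * w ^+ j.
Proof.
rewrite [p.[_]]horner_coef horner_sum; apply: eq_bigr => i _.
rewrite -rmorphXn /= hornerM hornerC horner_coef mulr_suml.
by apply: eq_bigr => j _; rewrite mulrAC.
Qed.

Definition poly2_row n (p : {poly {poly C}}) (z : C) (A : 'M[C]_n) (a : 'rV[C]_n) :=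
  \sum_(i < size p) \sum_(j < size p`_i) (p`_i`_j * z ^+ i) *: iter j (mulmxr A) a.

(* [U] is normal, so [p(z, U)] is unitarily diagonalizable with eigenvalues
   [p(z, w)], [w] in the spectrum of [U]. *)
Lemma poly2_row_norm n (p : {poly {poly C}}) (z s : C) (U : 'M[C]_n) :
  U \is unitarymx -> (forall w, eigenvalue U w -> `|p.[z, w]| ^+ 2 <= s) ->
  forall a : 'rV[C]_n, '[poly2_row p z U a] <= s * '[a].
Proof.
move=> UU ps a.
have /orthomx_spectralP : U \is normalmx.
  by apply/normalmxP; rewrite (unitarymxP UU) -invmx_unitary // mulVmx // unitarymx_unit.
set P := spectralmx U; set L := spectral_diag U => UE.
have PU : P \is unitarymx by exact: spectral_unitarymx.
have Pu : P \in unitmx by exact: unitarymx_unit.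
have eigL k : eigenvalue U (L 0 k).
  apply/eigenvalueP; exists (row k P); last first.
    apply/negP => /eqP Pk; have := row_unitarymxP PU k k.
    by rewrite Pk linear0l eqxx => /eqP; rewrite eq_sym oner_eq0.
  by rewrite UE !mulmxA -row_mul mulmxV // row1 -rowE row_diag_mx -scalemxAl -rowE.
have [b aE] : exists b, a = b *m P by exists (a *m invmx P); rewrite mulmxKV.
have iterE j : iter j (mulmxr U) a = (\row_k (b 0 k * L 0 k ^+ j)) *m P.
  elim: j => [|j IH] /=.
    by rewrite aE; congr (_ *m _); apply/rowP => k; rewrite mxE expr0 mulr1.
  rewrite IH UE !mulmxA mulmxK //; congr (_ *m _); apply/rowP => k.
  rewrite mul_mx_diag !mxE exprS; ring.
have -> : poly2_row p z U a = (\row_k (b 0 k * p.[z, L 0 k])) *m P.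
  rewrite /poly2_row; under eq_bigr do under eq_bigr do rewrite iterE scalemxAl.
  under eq_bigr do rewrite -mulmx_suml.
  rewrite -mulmx_suml; congr (_ *m _); apply/rowP => k.
  rewrite summxE mxE horner2_sum mulr_sumr; apply: eq_bigr => i _.
  rewrite summxE mulr_sumr; apply: eq_bigr => j _; rewrite !mxE; ring.
rewrite dotmx_unitary // aE dotmx_unitary // !dnormmx_sum mulr_sumr.
apply: ler_sum => k _; rewrite !mxE normrM exprMn mulrC.
by apply: ler_wpM2r; [rewrite exprn_ge0|exact/ps/eigL].
Qed.

(** Up to sign the determinant is the product of the [n] differences between [w] and the
    eigenvalues; if all had modulus at least [r], the product would be at least [r ^+ n]. *)
Lemma eigenvalue_near_det n (A : 'M[C]_n) (w r : C) : 0 <= r ->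
  `|\det (A - w%:M)| < r ^+ n -> exists2 w', eigenvalue A w' & `|w - w'| < r.
Proof.
move=> r0 detA; have [s sE] := closed_field_poly_normal (char_poly A).
rewrite (monicP (char_poly_monic A)) scale1r in sE.
have szs : size s = n.
  by have := size_char_poly A; rewrite sE size_prod_XsubC => -[].
have detE : `|\det (A - w%:M)| = \prod_(x <- s) `|w - x|.
  rewrite -opprB -scaleN1r detZ normrM normrX normrN1 expr1n mul1r -normr_prod.
  congr `|_|; transitivity (char_poly A).[w].
    rewrite /char_poly -horner_evalE -det_map_mx map_mxB map_scalar_mx /=.
    by rewrite map_polyCmx_eval horner_evalE hornerX.
  by rewrite sE horner_prod; apply: eq_bigr => x _; rewrite hornerXsubC.
have /hasP[x xs xr] : has (fun x => `|w - x| < r) s.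
  apply: contraTT detA; rewrite -all_predC detE => far.
  suff le : r ^+ n <= \prod_(x <- s) `|w - x|.
    by apply/negP => /(le_lt_trans le); rewrite ltxx.
  rewrite -szs; elim: s far {sE szs detE} => [|x s IH] /=; first by rewrite big_nil.
  rewrite -real_leNgt ?ger0_real // big_cons exprS => /andP[rx /IH].
  by apply: ler_pM => //; rewrite exprn_ge0.
exists x => //; rewrite eigenvalue_root_char sE root_prod_XsubC //.
Qed.

End TransferFunction.

(** * Polynomials in an operator *)

Section OperatorCalculus.
Variables (C : comNzRingType) (V : lmodType C) (T : {linear V -> V}).
Implicit Types (g h : {poly C}) (x y : V).

Definition poly_ev g x : V := \sum_(i < size g) g`_i *: iter i T x.

Lemma iter_linear i : linear (iter i T).
Proof. by elim: i => [|i IH] a x y //=; rewrite IH linearP. Qed.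

Lemma poly_ev_wide g n x : (size g <= n)%N ->
  poly_ev g x = \sum_(i < n) g`_i *: iter i T x.
Proof.
move=> gn; rewrite /poly_ev (big_ord_widen n (fun i => g`_i *: iter i T x)) //.
rewrite big_mkcond /=; apply: eq_bigr => i _; case: ltnP => // /(nth_default 0)->.
by rewrite scale0r.
Qed.

Lemma poly_ev_is_linear x : linear (poly_ev^~ x).
Proof.
move=> a g h; pose n := maxn (size (a *: g + h)) (maxn (size g) (size h)).
rewrite !(@poly_ev_wide _ n) ?leq_max ?leqnn ?orbT // scaler_sumr -big_split.
by apply: eq_bigr => i _; rewrite coefD coefZ scalerDl scalerA.
Qed.

Lemma poly_evr_is_linear g : linear (poly_ev g).
Proof.
move=> a x y; rewrite scaler_sumr -big_split; apply: eq_bigr => i _.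
by rewrite iter_linear scalerDr !scalerA mulrC.
Qed.
HB.instance Definition _ g := GRing.isLinear.Build C V V *:%R (poly_ev g)
  (poly_evr_is_linear g).

Lemma poly_ev0 x : poly_ev 0 x = 0.
Proof. by rewrite /poly_ev size_poly0 big_ord0. Qed.

Lemma poly_evD g h x : poly_ev (g + h) x = poly_ev g x + poly_ev h x.
Proof. by rewrite -[g]scale1r poly_ev_is_linear !scale1r. Qed.

Lemma poly_evZ a g x : poly_ev (a *: g) x = a *: poly_ev g x.
Proof. by rewrite -[_ *: g]addr0 poly_ev_is_linear poly_ev0 addr0. Qed.

Lemma poly_ev_sum I (r : seq I) (P : pred I) (F : I -> {poly C}) x :
  poly_ev (\sum_(i <- r | P i) F i) x = \sum_(i <- r | P i) poly_ev (F i) x.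
Proof. by apply: (big_morph (poly_ev^~ x)) => [g h|]; rewrite ?poly_evD ?poly_ev0. Qed.

Lemma poly_ev_commute (S : {linear V -> V}) g x :
  (forall y, S (T y) = T (S y)) -> S (poly_ev g x) = poly_ev g (S x).
Proof.
move=> ST; rewrite linear_sum; apply: eq_bigr => i _; rewrite linearZ /=.
by congr (_ *: _); elim: (nat_of_ord i) => //= j IH; rewrite ST IH.
Qed.

Lemma poly_ev_mulX g x : poly_ev ('X * g) x = T (poly_ev g x).
Proof.
rewrite -commr_polyX (@poly_ev_wide _ (size g).+1); last first.
  by rewrite (leq_trans (size_polyMleq _ _)) // size_polyX addn2.
rewrite big_ord_recl coefMX /= scale0r add0r linear_sum; apply: eq_bigr => i _.
by rewrite linearZ coefMX.
Qed.

Lemma poly_evC a x : poly_ev a%:P x = a *: x.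
Proof. by rewrite (@poly_ev_wide _ 1) ?size_polyC ?leq_b1 // big_ord1 coefC. Qed.

Lemma poly_ev1 x : poly_ev 1 x = x. Proof. by rewrite poly_evC scale1r. Qed.

Lemma poly_evM g h x : poly_ev (g * h) x = poly_ev g (poly_ev h x).
Proof.
elim/poly_ind: g => [|g a IH]; first by rewrite mul0r !poly_ev0.
rewrite mulrDl !poly_evD -mulrAC -!(mulrC 'X) !poly_ev_mulX IH; congr (_ + _).
by rewrite mul_polyC poly_evZ poly_evC.
Qed.

Lemma poly_ev_X i x : poly_ev 'X^i x = iter i T x.
Proof. by elim: i => [|i IH]; rewrite ?poly_ev1 // exprS poly_ev_mulX IH. Qed.

(** The map from the Hardy space to [V], on polynomials only, so that no series in [T] has to
    converge. *)
Definition polyrow_op n (u : 'I_n -> V) (F : 'rV[{poly C}]_n) : V :=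
  \sum_k poly_ev (F 0 k) (u k).

Lemma polyrow_opD n (u : 'I_n -> V) F G :
  polyrow_op u (F + G) = polyrow_op u F + polyrow_op u G.
Proof. by rewrite -big_split; apply: eq_bigr => k _; rewrite mxE poly_evD. Qed.

Lemma polyrow_op_scale n (u : 'I_n -> V) g F :
  polyrow_op u (g *: F) = poly_ev g (polyrow_op u F).
Proof. by rewrite linear_sum; apply: eq_bigr => k _; rewrite mxE poly_evM. Qed.

Lemma polyrow_op_sum n (u : 'I_n -> V) I (r : seq I) (P : pred I) (F : I -> 'rV_n) :
  polyrow_op u (\sum_(i <- r | P i) F i) = \sum_(i <- r | P i) polyrow_op u (F i).
Proof.
rewrite /polyrow_op exchange_big; apply: eq_bigr => k _ /=.
by rewrite summxE poly_ev_sum.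
Qed.

Lemma polyrow_op_mul n m (u : 'I_n -> V) (v : 'I_m -> V) (A : 'M[{poly C}]_(n, m)) F :
  (forall j, u j = \sum_k poly_ev (A j k) (v k)) ->
  polyrow_op u F = polyrow_op v (F *m A).
Proof.
move=> uE; rewrite /polyrow_op.
under eq_bigr do rewrite uE linear_sum /=; rewrite exchange_big /=.
apply: eq_bigr => k _; rewrite mxE poly_ev_sum; apply: eq_bigr => j _.
by rewrite poly_evM.
Qed.

End OperatorCalculus.

(** * Multiplication by the transfer function becomes the second operator *)

Section TransferOperator.
Variables (C : numClosedFieldType) (V : lmodType C) (T1 T2 : {linear V -> V}).
Hypothesis T12 : forall x, T1 (T2 x) = T2 (T1 x).
Variables (n1 n2 : nat) (M : 'M[C]_(n1 + n2)) (u : 'I_n1 -> V) (v : 'I_n2 -> V).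
Local Notation "A ^P" := (map_mx (@polyC C) A) (at level 8).
Hypothesis uE : forall j, T2 (u j) =
  \sum_k ulsubmx M j k *: u k + T1 (\sum_k ursubmx M j k *: v k).
Hypothesis vE : forall j, v j =
  \sum_k dlsubmx M j k *: u k + T1 (\sum_k drsubmx M j k *: v k).

Local Notation op := (polyrow_op T1).
Local Notation d := (\det (pencil M)).

Lemma polyrow_op_const n m (A : 'M[C]_(n, m)) (x : 'I_m -> V) (F : 'rV_n) :
  op (fun j => \sum_k A j k *: x k) F = op x (F *m A^P).
Proof.
by apply: polyrow_op_mul => j; apply: eq_bigr => k _; rewrite mxE poly_evC.
Qed.

Lemma polyrow_op_shift n m l (A : 'M[C]_(n, m)) (B : 'M[C]_(n, l)) x y (F : 'rV_n) :
  op (fun j => \sum_k A j k *: x k + T1 (\sum_k B j k *: y k)) F =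
  op x (F *m A^P) + op y ('X *: (F *m B^P)).
Proof.
rewrite polyrow_op_scale -!polyrow_op_const -['X]expr1 poly_ev_X /= linear_sum -big_split.
apply: eq_bigr => j _; rewrite /= linearD /=; congr (_ + _).
by rewrite (poly_ev_commute _ _ (S := T1)).
Qed.

(** The family [v] is eliminated between [uE] and [vE]. The pencil has no polynomial inverse in
    general, only its adjugate, hence the factor [d] on the left. *)
Lemma transfer_operator (F : 'rV_n1) :
  T2 (op u (d *: F)) = op u (F *m transfer_num M).
Proof.
(* This is [vE] with its [T1] term moved to the left: v (1 - T1 M22) = M21 u, for every polynomial
   row. *)
have v0 (G : 'rV_n2) : op v (G *m pencil M) = op u (G *m (dlsubmx M)^P).
  have := polyrow_op_shift (dlsubmx M) (drsubmx M) u v G.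
  have -> : op (fun j => \sum_k dlsubmx M j k *: u k + T1 (\sum_k drsubmx M j k *: v k)) G
    = op v G by apply: eq_bigr => j _; rewrite -vE.
  move=> vG; apply: (addIr (op v ('X *: (G *m (drsubmx M)^P)))).
  by rewrite -vG -polyrow_opD mulmxBr mulmx1 -scalemxAr subrK.
rewrite linear_sum /=.
transitivity (op (fun j => T2 (u j)) (d *: F)).
  by apply: eq_bigr => j _; rewrite (poly_ev_commute _ _ (S := T2)).
transitivity (op u (d *: F *m (ulsubmx M)^P) + op v ('X *: (d *: F *m (ursubmx M)^P))).
  by rewrite -polyrow_op_shift; apply: eq_bigr => j _; rewrite uE.
(* With the factor [d] the row becomes a multiple of the pencil, to which [v0] applies. *)
pose G := 'X *: (F *m (ursubmx M)^P *m \adj (pencil M)).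
have -> : 'X *: (d *: F *m (ursubmx M)^P) = G *m pencil M.
  by rewrite /G -scalemxAl -[RHS]scalemxAl -(mulmxA (_ *m _)) mul_adj_mx mul_mx_scalar.
rewrite v0 -polyrow_opD /transfer_num /G mulmxDr; congr (op u (_ + _)).
  by rewrite -scalemxAl -scalemxAr.
by rewrite -scalemxAl -[RHS]scalemxAr !mulmxA.
Qed.

Lemma iter_polyrow_op i n (x : 'I_n -> V) F :
  iter i T1 (op x F) = op x ('X^i *: F).
Proof. by rewrite polyrow_op_scale poly_ev_X. Qed.

(** Each application of [T2] consumes one factor [d]. *)
Lemma transfer_operator_iter j m (F : 'rV_n1) : (j <= m)%N ->
  iter j T2 (op u (d ^+ m *: F)) =
  op u (d ^+ (m - j) *: iter j (mulmxr (transfer_num M)) F).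
Proof.
elim: j => [|j IH] jm /=; first by rewrite subn0.
rewrite (IH (ltnW jm)).
set F' := iter j _ F.
have -> : d ^+ (m - j) *: F' = d *: (d ^+ (m - j.+1) *: F').
  by rewrite scalerA -exprS subnSK.
rewrite transfer_operator.
by rewrite -scalemxAl.
Qed.

(** The row [F] times d^m p(z, Phi z): degree [j] in the second variable uses [j] of the [m]
    denominators. Sizes at most [m] make every [m - j] an exact subtraction. *)
Definition poly2_transfer (p : {poly {poly C}}) m (F : 'rV_n1) : 'rV[{poly C}]_n1 :=
  \sum_(i < size p) \sum_(j < size p`_i)
    (p`_i`_j *: ('X^i * d ^+ (m - j))) *: iter j (mulmxr (transfer_num M)) F.

Lemma poly2_transfer_op (p : {poly {poly C}}) m F : (forall i, (size (p`_i)%R <= m)%N) ->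
  \sum_(i < size p) \sum_(j < size p`_i)
    p`_i`_j *: iter i T1 (iter j T2 (op u (d ^+ m *: F))) =
  op u (poly2_transfer p m F).
Proof.
move=> pm; rewrite polyrow_op_sum; apply: eq_bigr => i _.
rewrite polyrow_op_sum; apply: eq_bigr => j _.
have jm : (j <= m)%N by apply: leq_trans (pm i); apply: ltnW.
rewrite transfer_operator_iter // iter_polyrow_op scalerA.
by rewrite [in RHS]polyrow_op_scale poly_evZ -polyrow_op_scale.
Qed.

Lemma poly2_transfer_eval (p : {poly {poly C}}) m F z : 1%:M - z *: drsubmx M \in unitmx ->
  (forall i, (size (p`_i)%R <= m)%N) ->
  polyrow_eval z (poly2_transfer p m F) =
  d.[z] ^+ m *: poly2_row p z (transfer M z) (polyrow_eval z F).
Proof.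
move=> zU pm; rewrite /polyrow_eval /poly2_transfer map_mx_sum scaler_sumr.
apply: eq_bigr => i _; rewrite map_mx_sum scaler_sumr; apply: eq_bigr => j _.
have jm : (j <= m)%N by apply: leq_trans (pm i); apply: ltnW.
have iterE k : map_mx (horner_eval z) (iter k (mulmxr (transfer_num M)) F) =
    d.[z] ^+ k *: iter k (mulmxr (transfer M z)) (map_mx (horner_eval z) F).
  elim: k => [|k IH] /=; first by rewrite scale1r.
  by rewrite map_mxM IH transfer_num_eval // -scalemxAl -scalemxAr scalerA exprSr.
rewrite map_mxZ iterE !scalerA; congr (_ *: _).
rewrite /= horner_evalE hornerZ hornerM hornerXn horner_exp -[in RHS](subnK jm) exprD.
ring.
Qed.

End TransferOperator.

Local Open Scope classical_set_scope.
Local Open Scope complex_scope.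

(** * Hilbert spaces *)

Lemma real_complex_norm (R : realType) (V : normedModType R[i]) (x : V) :
  `|x| = (rnorm x)%:C.
Proof. by rewrite /rnorm RRe_real ?normr_real. Qed.

Section InnerProduct.
Variables (R : realType) (H : completeNormedModType R[i]).
Variable dot : {dot H for Num.conj}.
Hypothesis dot_norm : is_inner_product dot.
Implicit Types (x y z : H).

Lemma innerC x y : dot x y = (dot y x)^*%R.
Proof. by rewrite hermC expr0 mul1r. Qed.

Lemma sqr_normD x y : `|x + y| ^+ 2 = `|x| ^+ 2 + `|y| ^+ 2 + (dot x y + (dot x y)^*%R).
Proof. by rewrite -!dot_norm dnormD. Qed.

Lemma cauchy_schwarz x y : `|dot x y| <= `|x| * `|y|.
Proof.
have [->|y0] := eqVneq y 0; first by rewrite linear0r normr0 mulr_ge0.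
rewrite -(@ler_pXn2r _ 2) ?nnegrE ?mulr_ge0 // exprMn.
set a := dot x y; have [n nE] : exists n, n = `|y| ^+ 2 by exists (`|y| ^+ 2).
have n0 : 0 < n by rewrite nE exprn_gt0 // normr_gt0.
have nr : n^*%R = n by rewrite geC0_conj // ltW.
have := exprn_ge0 2 (normr_ge0 (n *: x - a *: y)).
rewrite sqr_normD -scaleNr linearZlr /= -/a !normrZ !exprMn normrN -nE.
rewrite [(n * _)^*%R]rmorphM /= [((- a)^*%R * a)^*%R]rmorphM /= conjCK nr rmorphN mulNr mulrN.
rewrite [in - a * _]mulNr !mulrN.
rewrite (ger0_norm (ltW n0)) -mulrA (mulrC a) -normCKC -opprD.
set b := `|a| ^+ 2; set m := `|x| ^+ 2.
have -> : n * (n * m) + b * n - (n * b + n * b) = n * (m * n - b) by ring.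
by rewrite pmulr_rge0 // subr_ge0.
Qed.

Lemma cauchy_seq_ex (z : nat -> H) (e : nat -> R) :
  (forall n k, `|z n - z k| <= (e n + e k)%:C) ->
  (forall r, 0 < r -> exists N, forall n, (N <= n)%N -> e n < r) ->
  exists l, forall r, 0 < r -> exists N, forall n, (N <= n)%N -> `|z n - l| < r%:C.
Proof.
move=> zz e0.
have : cauchy (z @ \oo).
  apply/cauchyP => r r0; have rE : r = (complex.Re r)%:C by rewrite RRe_real ?gtr0_real.
  have [|N NP] := e0 (complex.Re r / 2); first by rewrite divr_gt0 // -ltcR -rE.
  exists (z N); exists N => // n /= Nn; rewrite -ball_normE /=.
  apply: le_lt_trans (zz _ _) _; rewrite rE ltcR.
  by have := NP _ Nn; have := NP _ (leqnn N); lra.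
move/cauchy_cvgP/cvg_ex => [l /cvgrPdist_lt zl]; exists l => r r0.
have := zl r%:C; rewrite ltcR => /(_ r0) [N _ NP]; exists N => n Nn.
by rewrite distrC; exact: NP.
Qed.

Definition tends_to (z : nat -> H) l :=
  forall r : R, 0 < r -> exists N, forall n, (N <= n)%N -> `|z n - l| < r%:C.

(** The order on [R[i]] is partial; the two sign hypotheses make [a] and [b] real. *)
Lemma complex_le_eps (a b : R[i]) : 0 <= a -> 0 <= b ->
  (forall r : R, 0 < r -> a <= b + r%:C) -> a <= b.
Proof.
move=> a0 b0 ab; rewrite -[a]RRe_real ?ger0_real // -[b]RRe_real ?ger0_real // lecR.
apply/ler_addgt0Pr => r /ab; rewrite -lecR rmorphD /=.
by rewrite !RRe_real ?ger0_real.
Qed.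

Lemma inner_eps0 x : (forall r : R, 0 < r -> `|x| <= r%:C) -> x = 0.
Proof.
move=> xr; apply/eqP; rewrite -normr_eq0 eq_le normr_ge0 andbT.
by apply: complex_le_eps => // r /xr; rewrite add0r.
Qed.

Section Riesz.
Variable phi : {linear H -> R[i]}.
Variable c : R.
Hypothesis phi_bound : forall x, `|phi x| <= c%:C * `|x|.

(** When [phi] is the inner product with [z], this equals |x - z|^2 - |z|^2; the representing vector
    is its minimizer. *)
Let energy x : R := complex.Re (`|x| ^+ 2 - (phi x + (phi x)^*%R)).

Let energyE x : (energy x)%:C = `|x| ^+ 2 - (phi x + (phi x)^*%R).
Proof.
rewrite RRe_real // realB ?realX ?normr_real //.
by rewrite CrealE rmorphD /= conjCK addrC.
Qed.

Let energy_ge x : - c ^+ 2 <= energy x.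
Proof.
rewrite -lecR energyE rmorphN rmorphXn /=.
have le1 : phi x + (phi x)^*%R <= 2 * (c%:C * `|x|).
  apply: le_trans (real_ler_norm _) _; first by rewrite CrealE rmorphD /= conjCK addrC.
  apply: le_trans (ler_normD _ _) _; rewrite norm_conjC mulrDl mul1r; exact: lerD.
rewrite lerNl opprB lerBlDr (le_trans le1) // -subr_ge0.
have -> : c%:C ^+ 2 + `|x| ^+ 2 - 2 * (c%:C * `|x|) = (c%:C - `|x|) ^+ 2 by ring.
by rewrite real_exprn_even_ge0 // realB ?normr_real // complex_real eqxx.
Qed.

(* Testing near-minimality of the energy at [z] against [z + t x], with [t]
   chosen optimally, bounds the defect [phi x - dot x z] without any limit. *)
Let riesz_approx (r : R) : 0 < r ->
  exists z, forall x, `|phi x - dot x z| <= r%:C * `|x|.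
Proof.
move=> r0; have has_infE : has_inf (range energy).
  split; first by exists (energy 0), 0.
  by exists (- c ^+ 2) => _ [x _ <-]; exact: energy_ge.
have [_ [z _ <-] zr] := inf_adherent (exprn_gt0 2 r0) has_infE.
exists z => x; have [->|x0] := eqVneq x 0.
  by rewrite !linear0 linear0l subrr !normr0 mulr0.
have n0 : 0 < `|x| ^+ 2 by rewrite exprn_gt0 // normr_gt0.
set e := phi x - dot x z; pose t := e^*%R / `|x| ^+ 2.
(* Moving from [z] to [z + t *: x] lowers the energy by exactly |e|^2 / |x|^2, which is thus at most
   [r ^+ 2]. *)
have : energy z - r ^+ 2 <= energy (z + t *: x).
  rewrite lerBlDr (le_trans (ltW zr)) // lerD2r.
  by apply: ge_inf; [case: has_infE|exists (z + t *: x)].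
pose q := `|e| ^+ 2 / `|x| ^+ 2.
have qr : q^*%R = q by rewrite geC0_conj // divr_ge0 // exprn_ge0.
have te : t * e = q by rewrite /t /q normCKC mulrAC.
have tx : `|t *: x| ^+ 2 = q.
  rewrite normrZ exprMn /t normf_div norm_conjC normrX normr_id exprMn exprVn /q.
  by field; rewrite normr_eq0.
pose w := t * dot x z.
have tphi : t *: phi x = q + w by rewrite -[LHS]/(t * phi x) -te -mulrDr /e subrK.
have dotw : dot z (t *: x) = w^*%R by rewrite /w innerC linearZl_LR.
rewrite -lecR rmorphB /= !energyE sqr_normD tx dotw (linearD phi) (linearZ_LR phi) /= tphi.
rewrite !rmorphD /= qr conjCK rmorphXn /=.
set m := `|z| ^+ 2; set p := phi z => le1.
have : q <= r%:C ^+ 2 by rewrite -subr_ge0; move: le1; rewrite -subr_ge0; congr (0 <= _); ring.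
rewrite /q ler_pdivrMr // -exprMn ler_pXn2r ?nnegrE // mulr_ge0 // ler0c ltW //.
Qed.

(** Near-minimizers form a Cauchy sequence: with y = z_n - z_k, |y|^2 is the difference of their two
    defects at [y], hence at most (1/(n+1) + 1/(k+1)) |y|. *)
Lemma riesz_representation : exists z, forall x, phi x = dot x z.
Proof.
have [z zP] := choice (fun n => @riesz_approx _ (divr_gt0 ltr01 (ltr0Sn R n))).
have zz n k : `|z n - z k| <= (1 / n.+1%:R + 1 / k.+1%:R : R)%:C.
  set y := z n - z k; have [->|y0] := eqVneq y 0.
    by rewrite normr0 ler0c addr_ge0 // divr_ge0.
  rewrite -(@ler_pM2r _ `|y|) ?normr_gt0 // -expr2.
  have -> : `|y| ^+ 2 = `|(phi y - dot y (z k)) - (phi y - dot y (z n))|.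
    rewrite opprB addrC subrKA -linearBr /= dot_norm ger0_norm // exprn_ge0 //.
  apply: le_trans (ler_normB _ _) _; rewrite rmorphD mulrDl addrC.
  by apply: lerD.
have [|l zl] := cauchy_seq_ex zz.
  by move=> r r0; have [N _ NP] := near_infty_natSinv_lt (PosNum r0);
     exists N => n Nn; have := NP n Nn; rewrite /= div1r.
exists l => x; apply/eqP; rewrite -subr_eq0 -normr_eq0 eq_le normr_ge0 andbT.
have [x0|x0] := eqVneq x 0.
  by rewrite x0 (linear0 phi) linear0l subrr normr0.
apply: complex_le_eps => // r r0; rewrite add0r.
pose s := r / (2 * rnorm x).
have n0 : 0 < rnorm x by rewrite -ltcR -real_complex_norm normr_gt0.
have s0 : 0 < s by rewrite divr_gt0 // mulr_gt0.
have [N NP] := zl _ s0.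
have [N' _ NP'] := near_infty_natSinv_lt (PosNum s0).
pose n := maxn N N'.
have -> : phi x - dot x l = (phi x - dot x (z n)) + dot x (z n - l).
  by rewrite linearBr /= addrA subrK.
have -> : r%:C = s%:C * `|x| + `|x| * s%:C.
  rewrite real_complex_norm -!rmorphM -rmorphD; congr _%:C.
  by rewrite /s; field; rewrite gt_eqF.
apply: le_trans (ler_normD _ _) _; apply: lerD.
  apply: le_trans (zP _ _) _; rewrite ler_wpM2r // lecR ltW //.
  by have := NP' n (leq_maxr _ _); rewrite /= div1r.
apply: le_trans (cauchy_schwarz _ _) _; rewrite ler_wpM2l // ltW //.
exact: NP (leq_maxl _ _).
Qed.

End Riesz.

End InnerProduct.

Section Adjoint.
Variables (R : realType) (H : completeNormedModType R[i]).
Variable dot : {dot H for Num.conj}.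
Hypothesis dot_norm : is_inner_product dot.
Implicit Types (x y z : H).

Lemma inner_ext x y : (forall z, dot z x = dot z y) -> x = y.
Proof.
move=> xy; apply/eqP; rewrite -subr_eq0 -normr_eq0 -sqrf_eq0.
by rewrite -dot_norm linearBr /= xy subrr.
Qed.

Lemma adjoint_ex (T : {linear H -> H}) : Defs.contraction T ->
  exists S : {linear H -> H}, is_adjoint dot T S.
Proof.
move=> Tc; have [S SP] : exists S : H -> H, forall x y, dot (T x) y = dot x (S y).
  suff /choice [S SP] : forall y, exists z, forall x, dot (T x) y = dot x z by exists S.
  move=> y; have phi_lin : linear (fun x => dot (T x) y : R[i]).
    by move=> a u v; rewrite linearP linearPl.
  pose phi : {linear H -> R[i]} :=
    HB.pack (fun x => dot (T x) y : R[i]) (GRing.isLinear.Build _ _ _ _ _ phi_lin).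
  apply: (@riesz_representation _ _ _ dot_norm phi (rnorm y)) => x.
  apply: le_trans (cauchy_schwarz dot_norm _ _) _.
  by rewrite -real_complex_norm mulrC ler_wpM2l.
have S_lin : linear S.
  move=> a u v; apply: inner_ext => z.
  by rewrite -SP !linearDr !linearZr /= !SP.
pose SL : {linear H -> H} := HB.pack S (GRing.isLinear.Build _ _ _ _ _ S_lin).
by exists SL.
Qed.

Lemma adjointP (T : {linear H -> H}) : Defs.contraction T -> is_adjoint dot T (adjoint dot T).
Proof. by move=> /adjoint_ex; exact: getPex. Qed.

Variables (T : {linear H -> H}).
Hypothesis T_contr : Defs.contraction T.
Local Notation Ts := (adjoint dot T).

Lemma adjoint_sym x y : dot (Ts x) y = dot x (T y).
Proof. by rewrite (innerC dot) -adjointP // -(innerC dot). Qed.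

Lemma adjoint_contraction : Defs.contraction Ts.
Proof.
move=> x; have [->|n0] := eqVneq (Ts x) 0; first by rewrite normr0.
rewrite -(@ler_pM2r _ `|Ts x|) ?normr_gt0 // -expr2 -dot_norm -adjointP //.
rewrite -[leLHS]ger0_norm; last by rewrite adjointP // dot_norm exprn_ge0.
apply: le_trans (cauchy_schwarz dot_norm _ _) _.
by rewrite mulrC ler_wpM2l.
Qed.

Lemma iter_adjoint n x y : dot (iter n Ts x) y = dot x (iter n T y).
Proof. by elim: n y => [//|n IH] y; rewrite iterS adjoint_sym IH -iterSr. Qed.

Lemma iter_contraction (S : {linear H -> H}) n x : Defs.contraction S -> `|iter n S x| <= `|x|.
Proof. by move=> Sc; elim: n => //= n; apply: le_trans. Qed.

End Adjoint.

(** * Square roots of positive operators *)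

Section PositiveSqrt.
Variables (R : realType) (H : completeNormedModType R[i]).
Variable dot : {dot H for Num.conj}.
Hypothesis dot_norm : is_inner_product dot.
Variables (B : {linear H -> H}).
Hypothesis B_contr : Defs.contraction B.
Hypothesis B_sym : forall x y, dot (B x) y = dot x (B y).
Implicit Types (x y z : H).

Lemma poly_ev_norm (g : {poly R[i]}) x :
  `|poly_ev B g x| <= (\sum_(i < size g) `|g`_i|) * `|x|.
Proof.
apply: le_trans (ler_norm_sum _ _ _) _; rewrite mulr_suml; apply: ler_sum => i _.
by rewrite normrZ ler_wpM2l // iter_contraction.
Qed.

Definition poly_nneg (g : {poly R}) := forall i, 0 <= g`_i.

Lemma poly_nnegD g h : poly_nneg g -> poly_nneg h -> poly_nneg (g + h).
Proof. by move=> g0 h0 i; rewrite coefD addr_ge0. Qed.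

Lemma poly_nnegM g h : poly_nneg g -> poly_nneg h -> poly_nneg (g * h).
Proof. by move=> g0 h0 i; rewrite coefM sumr_ge0 // => j _; rewrite mulr_ge0. Qed.

Lemma poly_nnegC a : 0 <= a -> poly_nneg a%:P.
Proof. by move=> a0 i; rewrite coefC; case: ifP. Qed.

Definition real_ev (g : {poly R}) x := poly_ev B (map_poly (real_complex R) g) x.

(** Nonnegative coefficients turn the triangle inequality into the value at 1, so convergence of
    numbers yields convergence of operators. *)
Lemma real_ev_norm g x : poly_nneg g -> `|real_ev g x| <= (g.[1])%:C * `|x|.
Proof.
move=> g0; apply: le_trans (poly_ev_norm _ _) _; rewrite ler_wpM2r //.
rewrite size_map_inj_poly ?rmorph0 //; last exact: complexI.
rewrite horner_coef rmorph_sum /=; apply: ler_sum => i _.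
by rewrite coef_map /= expr1n mulr1 ger0_norm // ler0c.
Qed.

Lemma real_evB g h x : real_ev (g - h) x = real_ev g x - real_ev h x.
Proof.
apply/eqP; rewrite eq_sym subr_eq /real_ev -poly_evD -rmorphD /= subrK //.
Qed.

Lemma real_evM g h x : real_ev (g * h) x = real_ev g (real_ev h x).
Proof. by rewrite /real_ev rmorphM /= poly_evM. Qed.

Lemma real_evD g h x : real_ev (g + h) x = real_ev g x + real_ev h x.
Proof. by rewrite /real_ev rmorphD /= poly_evD. Qed.

Lemma real_evC a x : real_ev a%:P x = a%:C *: x.
Proof. by rewrite /real_ev map_polyC poly_evC. Qed.

Lemma real_evX x : real_ev 'X x = B x.
Proof. by rewrite /real_ev map_polyX -['X]mulr1 poly_ev_mulX poly_ev1. Qed.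

Lemma real_ev_self_adjoint g x : dot (real_ev g x) x \is Num.real.
Proof.
have Bn n u v : dot (iter n B u) v = dot u (iter n B v).
  by elim: n v => [//|n IH] v; rewrite iterS B_sym IH -iterSr.
rewrite /real_ev /poly_ev linear_sumlz /= rpred_sum // => i _.
rewrite linearZl_LR coef_map /= realM ?complex_real ?eqxx //.
by rewrite CrealE -(innerC dot) Bn.
Qed.

(* Iterates of [y |-> (t + y^2) / 2], whose fixed point is [1 - sqrt (1 - t)];
   their coefficients are nonnegative and increase, so convergence at [t = 1]
   gives convergence at [t = B]. *)
Fixpoint sqrt_poly n : {poly R} :=
  if n is m.+1 then 2^-1%:P * ('X + sqrt_poly m * sqrt_poly m) else 0.

Lemma sqrt_poly_nneg n : poly_nneg (sqrt_poly n).
Proof.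
elim: n => [|n IH] /=; first by move=> i; rewrite coef0.
apply: poly_nnegM; first by apply: poly_nnegC; rewrite invr_ge0.
by apply: poly_nnegD; [move=> i; rewrite coefX ler0n|exact: poly_nnegM].
Qed.

Lemma sqrt_poly_incr n : poly_nneg (sqrt_poly n.+1 - sqrt_poly n).
Proof.
elim: n => [|n IH]; first by rewrite [sqrt_poly 0]/= subr0; exact: sqrt_poly_nneg.
(* A difference of squares, whose two factors have nonnegative coefficients. *)
have -> : sqrt_poly n.+2 - sqrt_poly n.+1 =
    2^-1%:P * ((sqrt_poly n.+1 - sqrt_poly n) * (sqrt_poly n.+1 + sqrt_poly n)).
  rewrite [sqrt_poly n.+2]/= -/(sqrt_poly n.+1) [in X in _ - X = _]/=.
  by move: (sqrt_poly n.+1) (sqrt_poly n) => p q; ring.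
apply: poly_nnegM; first by apply: poly_nnegC; rewrite invr_ge0.
by apply: poly_nnegM IH _; apply: poly_nnegD; exact: sqrt_poly_nneg.
Qed.

Lemma sqrt_poly_mono m n : (m <= n)%N -> poly_nneg (sqrt_poly n - sqrt_poly m).
Proof.
move=> /subnKC <-; elim: (n - m)%N => [|k IH].
  by rewrite addn0 subrr => i; rewrite coef0.
by rewrite addnS -(subrKA (sqrt_poly (m + k))); apply: poly_nnegD => //; exact: sqrt_poly_incr.
Qed.

Lemma sqrt_poly_at1 n : (sqrt_poly n).[1] <= 1.
Proof.
have q0 m : 0 <= (sqrt_poly m).[1].
  rewrite horner_coef sumr_ge0 // => i _; rewrite expr1n mulr1; exact: sqrt_poly_nneg.
elim: n => [|n IH]; first by rewrite /= horner0.
by rewrite /= !hornerE; have := q0 n; nra.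
Qed.

(** The values [t n] at 1 increase and are bounded by 1; their distance to the supremum [L] is a
    Cauchy modulus. *)
Lemma sqrt_seq_lim x : exists l, tends_to (fun n => real_ev (sqrt_poly n) x) l.
Proof.
pose t n := (sqrt_poly n).[1]; pose L := sup (range t).
have Lsup : has_sup (range t).
  by split; [exists (t 0%N), 0%N|exists 1 => _ [n _ <-]; exact: sqrt_poly_at1].
have tL n : t n <= L by apply: ub_le_sup; [case: Lsup|exists n].
have t_mono m n : (m <= n)%N -> t m <= t n.
  move=> mn; rewrite -subr_ge0 /t -hornerN -hornerD horner_coef sumr_ge0 // => i _.
  by rewrite expr1n mulr1; exact: sqrt_poly_mono.
have bound m n : (m <= n)%N ->
    `|real_ev (sqrt_poly n) x - real_ev (sqrt_poly m) x| <= ((t n - t m) * rnorm x)%:C.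
  move=> mn; rewrite -real_evB; apply: le_trans (real_ev_norm _ (sqrt_poly_mono mn)) _.
  by rewrite hornerD hornerN [leRHS]rmorphM /= -real_complex_norm.
have x0 : 0 <= rnorm x by rewrite -ler0c -real_complex_norm.
apply: (@cauchy_seq_ex _ _ _ (fun n => (L - t n) * rnorm x)) => [n k|r r0].
  wlog kn : n k / (k <= n)%N.
    move=> W; have [|/ltnW] := leqP k n; first exact: W.
    by rewrite distrC [X in X%:C]addrC; exact: W.
  apply: le_trans (bound _ _ kn) _; rewrite lecR -mulrDl ler_wpM2r //.
  by have := tL n; have := tL k; have := t_mono _ _ kn; lra.
pose s := r / (1 + rnorm x).
have s0 : 0 < s by rewrite divr_gt0 // ltr_wpDr.
have [_ [N _ <-] NP] := sup_adherent s0 Lsup.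
exists N => n /t_mono Nn; have : r = s * (1 + rnorm x).
  by rewrite /s divfK // gt_eqF // ltr_wpDr.
rewrite -/L in NP; move: (tL n) NP; nra.
Qed.

End PositiveSqrt.

Section Limits.
Variables (R : realType) (H : completeNormedModType R[i]).

Lemma tends_toP (z : nat -> H) l : tends_to z l <-> z @ \oo --> l.
Proof.
split=> [zl|/cvgrPdist_lt zl].
  apply/cvgrPdist_lt => r r0; have rE : r = (complex.Re r)%:C by rewrite RRe_real ?gtr0_real.
  have [|N NP] := zl (complex.Re r); first by rewrite -ltcR -rE.
  by exists N => // n /NP; rewrite rE distrC.
move=> r r0; have := zl r%:C; rewrite ltcR => /(_ r0) [N _ NP]; exists N => n Nn.
by rewrite distrC; exact: NP.
Qed.

Lemma complex_ge0_lim (a : R[i]) :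
  (forall r : R, 0 < r -> exists2 b, 0 <= b & `|a - b| <= r%:C) -> 0 <= a.
Proof.
move=> ab; suff /eqP : `|a| - a = 0 by rewrite subr_eq0 => /eqP <-.
apply/eqP; rewrite -normr_eq0 eq_le normr_ge0 andbT.
apply: complex_le_eps => // r r0; rewrite add0r.
have [b b0 br] := ab _ (divr_gt0 r0 (ltr0Sn R 1)).
have -> : `|a| - a = (`|a| - `|b|) - (a - b) by rewrite (ger0_norm b0) opprB subrKA.
apply: le_trans (ler_normB _ _) _; rewrite [r in r%:C](splitr r) rmorphD /= lerD //.
by apply: le_trans (ler_dist_dist _ _) br.
Qed.

End Limits.

Section SqrtExists.
Variables (R : realType) (H : completeNormedModType R[i]).
Variable dot : {dot H for Num.conj}.
Hypothesis dot_norm : is_inner_product dot.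
Variables (B : {linear H -> H}).
Hypothesis B_contr : Defs.contraction B.
Hypothesis B_sym : forall x y, dot (B x) y = dot x (B y).
Implicit Types (x y z : H).

(** The limit [Y] satisfies 2Y = B + Y^2, so S = 1 - Y squares to 1 - B. Positivity passes to the
    limit from the iterates, which are symmetric contractions. *)
Lemma positive_sqrt_ex : exists S, is_positive_sqrt dot (fun x => x - B x) S.
Proof.
have [Y YP] := choice (sqrt_seq_lim B_contr).
pose q n x := real_ev B (sqrt_poly R n) x.
have Ycvg x : q ^~ x @ \oo --> Y x by apply/tends_toP; exact: YP.
have q1 n x : `|q n x| <= `|x|.
  apply: le_trans (real_ev_norm B_contr _ (@sqrt_poly_nneg R n)) _.
  by rewrite -[leRHS]mul1r ler_wpM2r // lecR sqrt_poly_at1.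
have lin_sub (f : H -> H) : linear f -> {morph f : x y / x - y}.
  by move=> f_lin x y; rewrite -scaleN1r addrC f_lin scaleN1r addrC.
have q_lin n : linear (q n) by exact: poly_evr_is_linear.
have Y_lin : linear Y.
  move=> a x y; apply: (@cvg_unique _ (@norm_hausdorff _ H) (q ^~ (a *: x + y) @ \oo)).
    exact: Ycvg.
  have -> : q ^~ (a *: x + y) = (fun n => a *: q n x + q n y) by apply/funext => n; rewrite q_lin.
  have aY := cvgZl_tmp (k := a) (Ycvg x) _; exact: (cvgD (aY _) (Ycvg y)).
have Y1 x : `|Y x| <= `|x|.
  apply: complex_le_eps => // r r0; have [N NP] := YP x r r0.
  rewrite -[Y x](subrKC (q N x)); apply: le_trans (ler_normD _ _) _.
  by apply: lerD; [exact: q1|rewrite distrC; exact/ltW/NP].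
have S_lin : linear (fun x => x - Y x).
  by move=> a x y; rewrite Y_lin scalerBr opprD addrACA.
pose S : {linear H -> H} := HB.pack (fun x => x - Y x) (GRing.isLinear.Build _ _ _ _ _ S_lin).
have Y2 x : Y x + Y x = B x + Y (Y x).
  apply: (@cvg_unique _ (@norm_hausdorff _ H) ((fun n => q n.+1 x + q n.+1 x) @ \oo)).
    have Y' : (fun n => q n.+1 x) @ \oo --> Y x by rewrite (cvg_shiftS (q ^~ x)).
    exact: (cvgD Y' Y').
  have qS n : q n.+1 x + q n.+1 x = B x + q n (q n x).
    have half : 2^-1 + 2^-1 = 1 :> R by field.
    rewrite /q /= real_evM real_evC real_evD real_evX real_evM.
    by rewrite -scalerDl -rmorphD half scale1r.
  have -> : (fun n => q n.+1 x + q n.+1 x) = (fun n => B x + q n (q n x)) by apply/funext.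
  (* The iterates [q n] are uniformly contractive, so the inner limit may be taken first. *)
  suff Y' : (fun n => q n (q n x)) @ \oo --> Y (Y x) by exact: (cvgD (cvg_cst (B x)) Y').
  apply/tends_toP => r r0; have r2 : 0 < r / 2 by rewrite divr_gt0.
  have [N NP] := YP x _ r2; have [N' NP'] := YP (Y x) _ r2.
  exists (maxn N N') => n; rewrite geq_max => /andP[/NP xn /NP' yn].
  rewrite -(subrK (q n (Y x)) (q n (q n x))) -addrA.
  apply: le_lt_trans (ler_normD _ _) _.
  rewrite [r in r%:C](splitr r) rmorphD /= ltrD //; apply: le_lt_trans xn.
  by have := q1 n (q n x - Y x); rewrite (lin_sub _ (q_lin n)).
exists S; split.
- apply/linear_bounded_continuous/bounded_funP => r; exists (r + r) => x xr /=.
  by apply: le_trans (ler_normB _ _) _; apply: lerD => //; apply: le_trans (Y1 x) xr.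
- move=> x /=; apply: complex_ge0_lim => r r0.
  pose s := r / (1 + rnorm x).
  have x0 : 0 <= rnorm x by rewrite -ler0c -real_complex_norm.
  have s0 : 0 < s by rewrite divr_gt0 // ltr_wpDr.
  have [N NP] := YP x s s0; exists (dot (x - q N x) x).
    rewrite linearBl /= subr_ge0 dot_norm.
    apply: le_trans (real_ler_norm (real_ev_self_adjoint B_sym _ _)) _.
    apply: le_trans (cauchy_schwarz dot_norm _ _) _; rewrite expr2.
    by apply: ler_wpM2r => //; exact: q1.
  rewrite -linearBl /= opprB addrC subrKA.
  apply: le_trans (cauchy_schwarz dot_norm _ _) _.
  apply: le_trans (ler_wpM2r (normr_ge0 x) (ltW (NP N (leqnn N)))) _.
  rewrite real_complex_norm -rmorphM lecR /s mulrAC ler_pdivrMr ?ltr_wpDr //.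
  by nra.
- move=> x /=; rewrite (lin_sub _ Y_lin) opprB.
  have -> : Y (Y x) = Y x + Y x - B x by rewrite Y2 addrC addKr.
  by rewrite [_ - B x - _]addrAC addrK subrKA.
Qed.

End SqrtExists.

(** * Finite-rank defect operators *)

Section Defect.
Variables (R : realType) (H : completeNormedModType R[i]).
Variable dot : {dot H for Num.conj}.
Hypothesis dot_norm : is_inner_product dot.
Implicit Types (x y z : H).

Definition orthonormal_family n (f : 'I_n -> H) :=
  forall i j, dot (f i) (f j) = (i == j)%:R.

(** The Gram matrix of [f], the identity of rank [m], factors through dimension [n]. *)
Lemma orthonormal_family_bound n m (e : 'I_n -> H) (f : 'I_m -> H) :
  (forall k, exists c : 'I_n -> R[i], f k = \sum_(i < n) c i *: e i) ->
  orthonormal_family f -> (m <= n)%N.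
Proof.
move=> /choice [c fE] fo.
pose A : 'M[R[i]]_(m, n) := \matrix_(k, i) c k i.
pose G : 'M[R[i]]_n := \matrix_(i, j) dot (e i) (e j).
pose A' : 'M[R[i]]_(n, m) := \matrix_(i, k) (c k i)^*%R.
have AGA : A *m (G *m A') = 1%:M.
  apply/matrixP => k l; rewrite [RHS]mxE -fo !fE linear_sumlz mxE.
  apply: eq_bigr => i _; rewrite linearZl_LR /= linear_sumr !mxE; congr (_ * _).
  by apply: eq_bigr => j _; rewrite linearZr !mxE /= mulrC.
rewrite -(mxrank1 R[i] m) -AGA; apply: leq_trans (mxrankM_maxl _ _) _.
exact: rank_leq_col.
Qed.

(** A maximal orthonormal family in [E] works even if the [e i] are dependent: a nonzero remainder
    of some [x], once normalized, would extend it. *)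
Lemma orthonormal_basis_ex n (e : 'I_n -> H) (E : set H) :
  E = [set x | exists c : 'I_n -> R[i], x = \sum_(i < n) c i *: e i] ->
  exists m (f : 'I_m -> H), [/\ orthonormal_family f, forall k, E (f k)
    & forall x, E x -> x = \sum_k dot x (f k) *: f k].
Proof.
move=> EE.
have E_lin a x y : E x -> E y -> E (a *: x + y).
  rewrite EE => -[c ->] [d ->]; exists (fun i => a * c i + d i).
  rewrite scaler_sumr -big_split; apply: eq_bigr => i _.
  by rewrite scalerDl scalerA.
have E0 : E 0 by rewrite EE; exists (fun=> 0); rewrite big1 // => i _; rewrite scale0r.
have E_sum m (c : 'I_m -> R[i]) (f : 'I_m -> H) :
    (forall k, E (f k)) -> E (\sum_k c k *: f k).
  move=> fE; apply: (big_ind E) => // [x y Ex Ey|k _].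
    by rewrite -[x]scale1r; exact: E_lin.
  by rewrite -[_ *: _]addr0; exact: E_lin.
pose P m := `[< exists f : 'I_m -> H, orthonormal_family f /\ forall k, E (f k) >].
have exP : exists m, P m by exists 0%N; apply/asboolP; exists (fun=> 0); split=> -[].
have boundP m : P m -> (m <= n)%N.
  move=> /asboolP [f [fo fE]]; apply: (@orthonormal_family_bound n m e f) => // k.
  by have := fE k; rewrite {1}EE.
have [m /asboolP [f [fo fE]] mmax] := ex_maxnP exP boundP.
exists m, f; split=> // x Ex; apply/eqP; rewrite -subr_eq0; set r := x - _.
apply: contraT => r0; have Er : E r.
  by rewrite /r addrC -scaleN1r; apply: E_lin => //; exact: E_sum.
have rf k : dot r (f k) = 0.
  rewrite /r linearBl /= linear_sumlz (bigD1 k) //= linearZl_LR /=.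
  rewrite [dot (f k) (f k)]fo eqxx mulr1 big1 ?addr0 ?subrr // => i ik.
  by rewrite linearZl_LR /= [dot (f i) (f k)]fo (negPf ik) mulr0.
have fr k : dot (f k) r = 0 by rewrite (innerC dot) rf conjC0.
pose g := `|r|^-1 *: r.
have gg : dot g g = 1.
  by rewrite dot_norm normrZ normfV normr_id mulVf ?normr_eq0 // expr1n.
pose f' (i : 'I_m.+1) := if unlift ord0 i is Some k then f k else g.
suff /mmax : P m.+1 by rewrite ltnn.
apply/asboolP; exists f'; split=> [i j|i]; rewrite /f'; last first.
  by case: (unliftP ord0 i) => [k _|_]; rewrite // /g -[_ *: _]addr0; exact: E_lin.
case: (unliftP ord0 i) => [k|] ->; case: (unliftP ord0 j) => [l|] ->.
- by rewrite fo (inj_eq lift_inj).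
- by rewrite /g linearZr /= fr mulr0.
- by rewrite /g linearZl_LR /= rf mulr0.
- by rewrite gg eqxx.
Qed.

(** Polarization: the sesquilinear form [B] vanishes on the diagonal; testing it on x + y and x + iy
    shows that it is zero. *)
Lemma positive_sym (S : {linear H -> H}) : (forall x, 0 <= dot (S x) x) ->
  forall x y, dot (S x) y = dot x (S y).
Proof.
move=> Spos x y; pose B x y := dot (S x) y - dot x (S y).
have B0 z : B z z = 0.
  by rewrite /B (innerC dot z) (geC0_conj (Spos z)) subrr.
have BD a b : B (a + b) (a + b) = B a a + B b b + (B a b + B b a).
  by rewrite /B (linearD S) !linearDl /= !linearDr /=; ring.
have e1 : B x y + B y x = 0 by have := BD x y; rewrite !B0 !add0r => <-.
have e2 : 'i%R * (B y x - B x y) = 0.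
  have := BD x ('i%R *: y); rewrite !B0 !add0r => /esym <-.
  rewrite /B (linearZ_LR S) !linearZr_LR !linearZl_LR /= conjCi; ring.
move/eqP: e2; rewrite mulf_eq0 (negPf (neq0Ci _)) /= subr_eq0 => /eqP e2.
move/eqP: e1; rewrite e2 -mulr2n mulrn_eq0 /= => /eqP.
by rewrite -/(B x y); move/eqP; rewrite subr_eq0 => /eqP.
Qed.

Variable T : {linear H -> H}.
Hypothesis T_contr : Defs.contraction T.
Local Notation Ts := (adjoint dot T).
Local Notation D := (defect_operator_adj dot T).

Lemma defect_operatorP : is_positive_sqrt dot (fun x => x - T (Ts x)) D.
Proof.
apply: (@getPex _ [set S : {linear H -> H} | is_positive_sqrt dot (fun x => x - T (Ts x)) S]).
have Bc : Defs.contraction (T \o Ts : {linear H -> H}).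
  move=> x /=; apply: le_trans (T_contr _) _.
  exact: (adjoint_contraction dot_norm T_contr).
apply: (positive_sqrt_ex dot_norm Bc) => x y /=.
by rewrite (adjointP dot_norm T_contr) (adjoint_sym dot_norm T_contr).
Qed.

(** Take u_k = D f_k for an orthonormal basis [f] of the closed range of [D]. A relation among the
    u_k gives [y] in that space with D y = 0; as [D] is symmetric, [y] is orthogonal to the range of
    [D], so all its coordinates vanish. *)
Lemma defect_decomposition : finite_dimensional (defect_space_adj dot T) ->
  exists n (u : 'I_n -> H),
    (forall x, x - T (Ts x) = \sum_k dot x (u k) *: u k) /\
    (forall c : 'rV[R[i]]_n, \sum_k c 0 k *: u k = 0 -> c = 0).
Proof.
move=> [n [e /orthonormal_basis_ex [m [f [fo fE fspan]]]]].
have [_ Dpos DD] := defect_operatorP; have Dsym := positive_sym Dpos.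
exists m, (D \o f); split=> [x|c c0] /=.
  rewrite -DD {1}(fspan (D x)); last by apply: subset_closure; exists x.
  by rewrite linear_sum; apply: eq_bigr => k _; rewrite linearZ /= Dsym.
pose y := \sum_k c 0 k *: f k.
have Dy : D y = 0 by rewrite linear_sum -[RHS]c0; apply: eq_bigr => k _; rewrite linearZ.
have fy k : dot (f k) y = 0.
  apply/eqP; rewrite -normr_eq0 eq_le normr_ge0 andbT.
  apply: complex_le_eps => // r r0; rewrite add0r.
  (* Adding 1 avoids a division by zero when [y] is zero. *)
  pose s := r / (1 + rnorm y).
  have y0 : 0 <= rnorm y by rewrite -ler0c -real_complex_norm.
  have s0 : 0 < s by rewrite divr_gt0 // ltr_wpDr.
  have [_ [[x _ <-] xs]] : range D `&` ball (f k) s%:C !=set0.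
    by apply: (fE k); apply: nbhsx_ballx; rewrite ltcR.
  rewrite -ball_normE /= in xs.
  have -> : dot (f k) y = dot (f k - D x) y.
    by rewrite linearBl /= Dsym Dy linear0r subr0.
  apply: le_trans (cauchy_schwarz dot_norm _ _) _.
  apply: le_trans (ler_wpM2r (normr_ge0 y) (ltW xs)) _.
  rewrite real_complex_norm -rmorphM lecR /s mulrAC ler_pdivrMr ?ltr_wpDr //.
  by nra.
apply/rowP => k; rewrite mxE -[LHS]conjCK -[RHS]conjC0; congr (_^*%R).
rewrite -(fy k) linear_sumr (bigD1 k) //= linearZr /= [dot (f k) (f k)]fo eqxx mulr1.
rewrite big1 ?addr0 // => i ik.
by rewrite linearZr /= [dot (f k) (f i)]fo eq_sym (negPf ik) mulr0.
Qed.

End Defect.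

(** * The structure matrix of a commuting pair *)

Section Structure.
Variables (R : realType) (H : completeNormedModType R[i]).
Variable dot : {dot H for Num.conj}.
Hypothesis dot_norm : is_inner_product dot.
Implicit Types (x y z h : H).

Lemma inner_frame n (X : 'I_n -> H) h h' :
  dotmx (\row_k dot h (X k)) (\row_k dot h' (X k)) =
  dot (\sum_k dot h (X k) *: X k) h'.
Proof.
rewrite dotmx_sum linear_sumlz; apply: eq_bigr => k _.
by rewrite !mxE linearZl_LR -(innerC dot).
Qed.

(** Equal frame operators give the rows of inner products equal Gram matrices. Testing on the
    members of [X] and [Y] suffices: the error [Y j - Yj] lies in their span and is orthogonal to
    each of them. *)
Lemma frame_transfer n (X Y : 'I_n -> H) :
  (forall h, \sum_k dot h (X k) *: X k = \sum_k dot h (Y k) *: Y k) ->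
  exists2 M : 'M[R[i]]_n, M \is unitarymx & forall j, Y j = \sum_k M j k *: X k.
Proof.
move=> XY; pose fam := codom X ++ codom Y.
pose rows h := (\row_k dot h (X k), \row_k dot h (Y k)).
have [|W WU WE] := @unitary_transfer _ _ (map rows fam).
  by move=> _ _ /mapP[h _ ->] /mapP[h' _ ->]; rewrite /= !inner_frame XY.
(* Moving coefficients into the conjugate-linear second argument turns [W] into its conjugate
   transpose. *)
exists (W^t* )%sesqui; first by rewrite trmxC_unitary.
move=> j; set Yj := \sum_k _; apply/eqP; rewrite -subr_eq0.
have famE h : h \in fam -> dot h (Y j - Yj) = 0.
  move=> hf; have /(congr1 (fun a : 'rV_n => a 0 j)) := WE _ (map_f rows hf).
  rewrite !mxE linearBr /= => <-; apply/eqP; rewrite subr_eq0 linear_sumr; apply/eqP.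
  by apply: eq_bigr => k _; rewrite linearZr !mxE /= conjCK mulrC.
rewrite -normr_eq0 -sqrf_eq0 -dot_norm {1}/Yj linearBl /= linear_sumlz.
rewrite famE ?mem_cat ?codom_f ?orbT // sub0r oppr_eq0 big1 // => k _.
by rewrite linearZl_LR /= famE ?mulr0 // mem_cat codom_f.
Qed.

Variables (T1 T2 : {linear H -> H}).
Hypothesis T12 : forall x, T1 (T2 x) = T2 (T1 x).
Hypothesis T1_contr : Defs.contraction T1.
Hypothesis T2_contr : Defs.contraction T2.
Variables (n1 n2 : nat) (u : 'I_n1 -> H) (v : 'I_n2 -> H).
Hypothesis uP : forall x, x - T1 (adjoint dot T1 x) = \sum_k dot x (u k) *: u k.
Hypothesis vP : forall x, x - T2 (adjoint dot T2 x) = \sum_k dot x (v k) *: v k.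

Lemma adjoint_comm x :
  adjoint dot T1 (adjoint dot T2 x) = adjoint dot T2 (adjoint dot T1 x).
Proof.
apply: (inner_ext dot_norm) => z.
by rewrite -!(adjointP dot_norm) // T12.
Qed.

Lemma structure_matrix_ex : exists2 M : 'M[R[i]]_(n1 + n2), M \is unitarymx &
  (forall j, T2 (u j) =
    \sum_k ulsubmx M j k *: u k + T1 (\sum_k ursubmx M j k *: v k)) /\
  (forall j, v j =
    \sum_k dlsubmx M j k *: u k + T1 (\sum_k drsubmx M j k *: v k)).
Proof.
pose X k := match fintype.split k with inl i => u i | inr j => T1 (v j) end.
pose Y k := match fintype.split k with inl i => T2 (u i) | inr j => v j end.
have Xl i : X (lshift n2 i) = u i.
  by rewrite /X (unsplitK (inl i)).
have Xr i : X (rshift n1 i) = T1 (v i).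
  by rewrite /X (unsplitK (inr i)).
have Yl i : Y (lshift n2 i) = T2 (u i).
  by rewrite /Y (unsplitK (inl i)).
have Yr i : Y (rshift n1 i) = v i.
  by rewrite /Y (unsplitK (inr i)).
(* Writing S1, S2 for the adjoints, this is (1 - T1 S1) + T1 (1 - T2 S2) S1 = T2 (1 - T1 S1) S2 + (1
   - T2 S2). *)
have [h|M MU ME] := @frame_transfer _ X Y.
  rewrite !big_split_ord /=.
  under eq_bigr do rewrite Xl.
  under [X in _ + X]eq_bigr do rewrite Xr -(adjoint_sym dot_norm T1_contr) -linearZ.
  under [in RHS]eq_bigr do rewrite Yl -(adjoint_sym dot_norm T2_contr) -linearZ.
  under [X in _ = _ + X]eq_bigr do rewrite Yr.
  rewrite -uP -vP -!linear_sum -uP -vP !linearB /= addrA subrK.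
  by rewrite [RHS]addrC addrA subrK adjoint_comm T12.
have YE j : Y j = \sum_k M j (lshift n2 k) *: u k + T1 (\sum_k M j (rshift n1 k) *: v k).
  rewrite ME big_split_ord linear_sum /=; congr (_ + _); apply: eq_bigr => k _.
    by rewrite Xl.
  by rewrite Xr linearZ.
exists M => //; split=> j; [rewrite -Yl|rewrite -[LHS]Yr]; rewrite YE.
  by congr (_ + T1 _); apply: eq_bigr => k _; rewrite !mxE.
by congr (_ + T1 _); apply: eq_bigr => k _; rewrite !mxE.
Qed.

End Structure.

(** * Pure contractions *)

Section Purity.
Variables (R : realType) (H : completeNormedModType R[i]).
Variable dot : {dot H for Num.conj}.
Hypothesis dot_norm : is_inner_product dot.
Variable T : {linear H -> H}.
Hypothesis T_pure : pure_contraction dot T.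
Implicit Types (x y z h : H).

Lemma pure_adjoint_tends h : tends_to (fun m => iter m (adjoint dot T) h) 0.
Proof.
have [_ /(_ h) /cvgr0Pnorm_lt T0] := T_pure.
move=> r r0; have := T0 r%:C; rewrite ltcR => /(_ r0) [N _ NP].
by exists N => n /NP /=; rewrite normr_id subr0.
Qed.

(** For such [x], |x|^2 is the modulus of the inner product of [x] with T^N x, that is, of the N-th
    adjoint iterate with [x], which tends to 0. *)
Lemma pure_no_unimodular_eigenvector w x : `|w| = 1 -> T x = w *: x -> x = 0.
Proof.
move=> w1 Tx; have [Tc _] := T_pure.
have Tn n : iter n T x = w ^+ n *: x.
  elim: n => [|n IH] /=; first by rewrite scale1r.
  by rewrite IH linearZ /= Tx scalerA exprSr.
apply/eqP; rewrite -normr_eq0 -sqrf_eq0 eq_le exprn_ge0 // andbT.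
apply: complex_le_eps => // r r0.
rewrite add0r; pose s := r / (1 + rnorm x).
have x0 : 0 <= rnorm x by rewrite -ler0c -real_complex_norm.
have s0 : 0 < s by rewrite divr_gt0 // ltr_wpDr.
have [N /(_ N (leqnn N))] := pure_adjoint_tends x s0; rewrite subr0 => NP.
have -> : `|x| ^+ 2 = `|dot (iter N (adjoint dot T) x) x|.
  rewrite (iter_adjoint dot_norm Tc) Tn linearZr /= normrM norm_conjC normrX w1 expr1n mul1r.
  by rewrite dot_norm ger0_norm // exprn_ge0.
apply: le_trans (cauchy_schwarz dot_norm _ _) _.
apply: le_trans (ler_wpM2r (normr_ge0 x) (ltW NP)) _.
rewrite real_complex_norm -rmorphM lecR /s mulrAC ler_pdivrMr ?ltr_wpDr //.
by nra.
Qed.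

End Purity.

(** * Contractivity and approximate surjectivity of the Hardy space map *)

Section NormBound.
Variables (R : realType) (H : completeNormedModType R[i]).
Variable dot : {dot H for Num.conj}.
Hypothesis dot_norm : is_inner_product dot.
Variable T : {linear H -> H}.
Hypothesis T_contr : Defs.contraction T.
Variables (n : nat) (u : 'I_n -> H).
Hypothesis uP : forall x, x - T (adjoint dot T x) = \sum_k dot x (u k) *: u k.
Implicit Types (x y z h : H).
Local Notation Ts := (adjoint dot T).

(** The numbers on the left are the Hardy coefficients of [h]. For a pure [T] the last term tends to
    0, and the coefficient map is isometric in the limit. *)
Lemma bessel_telescope h N :
  \sum_(i < N) \sum_k `|dot (iter i Ts h) (u k)| ^+ 2 = `|h| ^+ 2 - `|iter N Ts h| ^+ 2.
Proof.
elim: N => [|N IH]; first by rewrite big_ord0 subrr.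
rewrite big_ord_recr IH /=; set g := iter N Ts h.
have -> : \sum_k `|dot g (u k)| ^+ 2 = `|g| ^+ 2 - `|Ts g| ^+ 2.
  transitivity (dot (g - T (Ts g)) g).
    rewrite uP linear_sumlz; apply: eq_bigr => k _.
    by rewrite linearZl_LR normCK /= -(innerC dot).
  by rewrite linearBl /= (adjointP dot_norm T_contr) !dot_norm.
by rewrite addrA subrK.
Qed.

Lemma defect_telescope h N :
  \sum_(i < N) iter i T (\sum_k dot (iter i Ts h) (u k) *: u k) = h - iter N T (iter N Ts h).
Proof.
elim: N => [|N IH]; first by rewrite big_ord0 subrr.
rewrite big_ord_recr IH /= -uP.
have lin : linear (iter N T) by exact: iter_linear.
have -> : iter N T (iter N Ts h - T (Ts (iter N Ts h))) =
    iter N T (iter N Ts h) - iter N T (T (Ts (iter N Ts h))).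
  by rewrite addrC -scaleN1r lin scaleN1r addrC.
by rewrite addrA subrK -iterSr.
Qed.

Lemma polyrow_norm2_wide N (F : 'rV[{poly R[i]}]_n) : (forall k, (size (F 0%R k) <= N)%N) ->
  polyrow_norm2 F = \sum_(i < N) \sum_k `|(F 0 k)`_i| ^+ 2.
Proof.
move=> FN; rewrite exchange_big; apply: eq_bigr => k _.
rewrite (big_ord_widen N (fun i => `|(F 0 k)`_i| ^+ 2)) // big_mkcond /=.
apply: eq_bigr => i _; case: ltnP => // /(nth_default 0)->.
by rewrite normr0 expr0n.
Qed.

(* [2 Re (a * conj b) <= |a|^2 + |b|^2] replaces Cauchy-Schwarz. *)
Lemma polyrow_op_norm (F : 'rV[{poly R[i]}]_n) :
  `|polyrow_op T u F| ^+ 2 <= polyrow_norm2 F.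
Proof.
pose N := \max_k size (F 0%R k); have FN k : (size (F 0%R k) <= N)%N by exact: (leq_bigmax k).
rewrite (polyrow_norm2_wide FN).
set h := polyrow_op T u F; pose c (i : nat) k := dot (iter i Ts h) (u k).
have hh : dot h h = \sum_(i < N) \sum_k (F 0 k)`_i * (c i k)^*%R.
  rewrite {1}/h /polyrow_op linear_sumlz exchange_big; apply: eq_bigr => k _ /=.
  rewrite (poly_ev_wide T (u k) (FN k)) linear_sumlz; apply: eq_bigr => i _.
  by rewrite linearZl_LR /c (iter_adjoint dot_norm T_contr) -(innerC dot).
have cc : \sum_(i < N) \sum_k `|c i k| ^+ 2 <= `|h| ^+ 2.
  by rewrite bessel_telescope gerBl exprn_ge0.
have h2 : `|h| ^+ 2 + `|h| ^+ 2 <= \sum_(i < N) \sum_k `|(F 0 k)`_i| ^+ 2 + `|h| ^+ 2.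
  apply: le_trans (lerD (lexx _) cc).
  have -> : `|h| ^+ 2 + `|h| ^+ 2 = dot h h + (dot h h)^*%R.
    by rewrite dot_norm geC0_conj // exprn_ge0.
  rewrite hh rmorph_sum -!big_split /=; apply: ler_sum => i _.
  rewrite rmorph_sum -!big_split /=; apply: ler_sum => k _.
  rewrite rmorphM /= conjCK -subr_ge0 !normCK.
  set a := (F 0 k)`_i; set b := c i k.
  have -> : a * a^*%R + b * b^*%R - (a * b^*%R + a^*%R * b) = (a - b) * (a - b)^*%R.
    by rewrite rmorphB /=; ring.
  by rewrite -normCK exprn_ge0.
by rewrite lerD2r in h2.
Qed.

(** The row collects the first [N] Hardy coefficients of [h]; when [T] is pure the remainder tends
    to 0. *)
Lemma polyrow_approx h N : exists2 F : 'rV[{poly R[i]}]_n,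
  polyrow_op T u F = h - iter N T (iter N Ts h) & polyrow_norm2 F <= `|h| ^+ 2.
Proof.
pose F : 'rV[{poly R[i]}]_n := \row_k \poly_(i < N) dot (iter i Ts h) (u k).
have FN k : (size (F 0%R k) <= N)%N by rewrite mxE size_poly.
have Fi k (i : 'I_N) : (F 0 k)`_i = dot (iter i Ts h) (u k).
  by rewrite mxE coef_poly ltn_ord.
exists F.
  rewrite -defect_telescope /polyrow_op.
  under eq_bigr do rewrite (poly_ev_wide T _ (FN _)).
  rewrite exchange_big; apply: eq_bigr => i _ /=.
  have lin : linear (iter i T) by exact: iter_linear.
  pose S : {linear H -> H} := HB.pack (iter i T) (GRing.isLinear.Build _ _ _ _ _ lin).
  rewrite -[RHS]/(S _) linear_sum; apply: eq_bigr => k _.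
  by rewrite linearZ /= Fi.
rewrite (polyrow_norm2_wide FN).
under eq_bigr do under eq_bigr do rewrite Fi.
by rewrite bessel_telescope gerBl exprn_ge0.
Qed.

End NormBound.

(** * Polynomial approximation of inverses on the closed disc *)

Section InverseApprox.
Variable R : realType.
Implicit Types g e : {poly R[i]}.

Definition approx_invertible g := forall r : R, 0 < r ->
  exists e, forall w, `|w| <= 1 -> `|(g * e).[w] - 1| <= r%:C.

Lemma approx_invertibleM g h :
  approx_invertible g -> approx_invertible h -> approx_invertible (g * h).
Proof.
(* The error of the product is at most t^2 + t + t, which is at most 3t, hence at most [r], as t <=
   1. *)
move=> gP hP r r0; pose t := Num.min (r / 3) 1.
have t0 : 0 < t by rewrite lt_min ltr01 divr_gt0.
have [e eP] := gP t t0; have [f fP] := hP t t0.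
exists (e * f) => w w1; rewrite mulrACA hornerM.
set a := (g * e).[w]; set b := (h * f).[w].
have -> : a * b - 1 = (a - 1) * (b - 1) + (a - 1) + (b - 1) by ring.
apply: le_trans (ler_normD _ _) _; apply: le_trans (lerD (ler_normD _ _) (lexx _)) _.
rewrite normrM; apply: le_trans (_ : (t * t + t + t)%:C <= _).
  rewrite !rmorphD rmorphM /= !lerD ?eP ?fP // ler_pM ?eP ?fP //.
rewrite lecR; have : t <= r / 3 by rewrite ge_min lexx.
have : t <= 1 by rewrite ge_min lexx orbT.
nra.
Qed.

Lemma approx_invertibleC a : a != 0 -> approx_invertible a%:P.
Proof.
move=> a0 r r0; exists a^-1%:P => w _.
by rewrite -polyCM divff // hornerC subrr normr0 ler0c ltW.
Qed.

(** A truncated geometric series in w/z; its error is exactly -(w/z)^N. *)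
Lemma approx_invertible_XsubC z : 1 < `|z| -> approx_invertible ('X - z%:P).
Proof.
move=> z1 r r0; have z0 : z != 0 by rewrite -normr_gt0 (lt_trans ltr01).
pose t := complex.Re `|z^-1|; have tE : `|z^-1| = t%:C by rewrite RRe_real ?normr_real.
have t0 : 0 <= t by rewrite -ler0c -tE.
have t1 : `|t| < 1.
  by rewrite ger0_norm // -ltcR -tE normfV invf_lt1 // (lt_trans ltr01).
have /cvgr0Pnorm_lt /(_ r r0) [N _ /(_ N (leqnn N)) /= tN] := cvg_expr t1.
exists ((- z^-1) *: \poly_(k < N) z^-1 ^+ k) => w w1.
have -> : (('X - z%:P) * ((- z^-1) *: \poly_(k < N) z^-1 ^+ k)).[w] - 1 = - (w / z) ^+ N.
  rewrite hornerM hornerZ hornerXsubC horner_poly.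
  have -> : \sum_(i < N) z^-1 ^+ i * w ^+ i = \sum_(i < N) (w / z) ^+ i.
    by apply: eq_bigr => i _; rewrite exprMn mulrC.
  have -> : (w - z) * (- z^-1 * \sum_(i < N) (w / z) ^+ i) =
      - ((w / z - 1) * \sum_(i < N) (w / z) ^+ i).
    by move: (\sum_(i < N) _) => S; field.
  by rewrite -subrX1 opprB addrC addrA addNr add0r.
rewrite normrN normrX normrM exprMn tE; apply: (@le_trans _ _ (1 * t%:C ^+ N)).
  by rewrite ler_wpM2r ?exprn_ge0 ?ler0c // exprn_ile1.
by rewrite mul1r -rmorphXn lecR; apply: le_trans (ler_norm _) (ltW tN).
Qed.

Lemma approx_invertible_neq0 g : (forall z, `|z| <= 1 -> g.[z] != 0) -> approx_invertible g.
Proof.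
move=> g0; have [s gE] := closed_field_poly_normal g.
have lc0 : lead_coef g != 0.
  apply: contraNneq (g0 0 _); rewrite ?normr0 // => lc; rewrite gE lc scale0r horner0 //.
have s1 : {in s, forall z, 1 < `|z|}.
  move=> z zs; rewrite real_ltNge ?normr_real ?real1 //; apply: contraL zs => z1.
  by rewrite -root_prod_XsubC; have := g0 _ z1; rewrite gE hornerZ mulf_eq0 (negPf lc0).
rewrite gE -mul_polyC; apply: approx_invertibleM; first exact: approx_invertibleC.
elim: s s1 {gE} => [|z s IH] s1.
  by rewrite big_nil -[1]/(1%:P); apply: approx_invertibleC; rewrite oner_eq0.
rewrite big_cons; apply: approx_invertibleM.
  by apply: approx_invertible_XsubC; apply: s1; rewrite mem_head.
by apply: IH => x xs; apply: s1; rewrite inE xs orbT.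
Qed.

End InverseApprox.

(** * The von Neumann inequality on the circle *)

Section VonNeumann.
Variables (R : realType) (H : completeNormedModType R[i]).
Variable dot : {dot H for Num.conj}.
Hypothesis dot_norm : is_inner_product dot.
Variables T1 T2 : {linear H -> H}.
Hypothesis T12 : forall x, T1 (T2 x) = T2 (T1 x).
Hypothesis T1_pure : pure_contraction dot T1.
Hypothesis T2_contr : Defs.contraction T2.
Variables (n1 n2 : nat) (M : 'M[R[i]]_(n1 + n2)) (u : 'I_n1 -> H) (v : 'I_n2 -> H).
Hypothesis uP : forall x, x - T1 (adjoint dot T1 x) = \sum_k dot x (u k) *: u k.
Hypothesis uE : forall j, T2 (u j) =
  \sum_k ulsubmx M j k *: u k + T1 (\sum_k ursubmx M j k *: v k).
Hypothesis vE : forall j, v j =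
  \sum_k dlsubmx M j k *: u k + T1 (\sum_k drsubmx M j k *: v k).
Hypothesis MU : M \is unitarymx.
Hypothesis M22_pure : forall (b : 'rV[R[i]]_n2) w,
  `|w| = 1 -> b *m drsubmx M = w *: b -> b = 0.
Variable p : {poly {poly R[i]}}.

Let T1_contr : Defs.contraction T1. Proof. by case: T1_pure. Qed.

Lemma poly_opB x y : poly_op p T1 T2 (x - y) = poly_op p T1 T2 x - poly_op p T1 T2 y.
Proof.
rewrite /poly_op -sumrB; apply: eq_bigr => i _; rewrite -sumrB; apply: eq_bigr => j _.
rewrite -scalerBr; congr (_ *: _).
have lin T n : {morph iter n (T : {linear H -> H}) : x y / x - y}.
  by move=> a b; elim: n => //= n ->; rewrite linearB.
by rewrite !lin.
Qed.

Lemma poly_op_bounded : exists2 c : R, 0 <= c & forall x, `|poly_op p T1 T2 x| <= c%:C * `|x|.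
Proof.
exists (\sum_(i < size p) \sum_(j < size p`_i) complex.Re `|p`_i`_j|).
  by rewrite sumr_ge0 // => i _; rewrite sumr_ge0 // => j _; rewrite -ler0c RRe_real ?normr_real.
move=> x; apply: le_trans (ler_norm_sum _ _ _) _; rewrite rmorph_sum mulr_suml.
apply: ler_sum => i _; apply: le_trans (ler_norm_sum _ _ _) _; rewrite rmorph_sum mulr_suml.
apply: ler_sum => j _.
rewrite normrZ -[leRHS]/((complex.Re `|p`_i`_j|)%:C * _) RRe_real ?normr_real // ler_wpM2l //.
by apply: le_trans (iter_contraction _ _ T1_contr) (iter_contraction _ _ T2_contr).
Qed.

Variable s : R.
Hypothesis s0 : 0 <= s.
Hypothesis ps : forall z w, `|z| = 1 -> eigenvalue (transfer M z) w -> `|p.[z, w]| <= s%:C.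
Local Notation d := (\det (pencil M)).

(** The contractive Hardy space map reduces the claim to rows of polynomials. On the circle these
    are d^m F times p(z, Phi z) with Phi z unitary, so [poly2_row_norm] applies pointwise. *)
Lemma poly_op_transfer_bound m (F : 'rV[{poly R[i]}]_n1) :
  (forall i, (size (p`_i)%R <= m)%N) ->
  `|poly_op p T1 T2 (polyrow_op T1 u (d ^+ m *: F))| ^+ 2 <=
  s%:C ^+ 2 * polyrow_norm2 (d ^+ m *: F).
Proof.
move=> pm; rewrite /poly_op (poly2_transfer_op T12 uE vE) //.
apply: le_trans (polyrow_op_norm dot_norm T1_contr uP _) _.
apply: polyrow_norm2_le => w w1.
have wU : 1%:M - w *: drsubmx M \in unitmx by apply: pencil_unit => //; rewrite w1.
rewrite (poly2_transfer_eval _ wU) // /polyrow_eval map_mxZ /= horner_evalE horner_exp !dnormZ.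
rewrite mulrCA ler_wpM2l ?exprn_ge0 //; apply: poly2_row_norm.
  exact: transfer_unitary.
by move=> z zE; rewrite ler_pXn2r ?nnegrE ?normr_ge0 ?ler0c //; exact: (ps w1 zE).
Qed.

(* The factor [d ^+ m] clears the denominators of the transfer function; on the
   circle it is undone up to [t] by a polynomial [e]. *)
Lemma poly_op_bound h : `|poly_op p T1 T2 h| <= s%:C * `|h|.
Proof.
apply: complex_le_eps => // [|r r0]; first by rewrite mulr_ge0 ?ler0c.
have [c c0 cP] := poly_op_bounded.
pose m := \max_(i < size p) size (p`_i)%R.
have pm i : (size (p`_i)%R <= m)%N.
  have [ip|/(nth_default 0) ->] := ltnP i (size p); last by rewrite size_poly0.
  exact: (leq_bigmax (Ordinal ip)).
have h0 : 0 <= rnorm h by rewrite -ler0c -real_complex_norm.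
(* The three error terms s t |h|, c t |h| and c t add up to t a. *)
pose a := s * rnorm h + c * rnorm h + c.
have a0 : 0 <= a by rewrite /a !addr_ge0 ?mulr_ge0.
pose t := r / (1 + a); have t0 : 0 < t by rewrite divr_gt0 // ltr_wpDr.
have [e eP] : exists e : {poly R[i]}, forall w, `|w| <= 1 -> `|(d ^+ m * e).[w] - 1| <= t%:C.
  apply: approx_invertible_neq0 => // z z1; rewrite horner_exp expf_neq0 //.
  exact: det_pencil_neq0.
have [N /(_ N (leqnn N))] := pure_adjoint_tends T1_pure h t0; rewrite subr0 => NP.
have [F FE Fn] := polyrow_approx dot_norm T1_contr uP h N.
have tC : 0 <= t%:C by rewrite ler0c ltW.
have t1C : 0 <= (1 + t)%:C by rewrite ler0c addr_ge0 // ltW.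
have sC : 0 <= s%:C by rewrite ler0c.
have sq (b b' : R[i]) : 0 <= b -> 0 <= b' -> b ^+ 2 <= b' ^+ 2 -> b <= b'.
  by move=> b0 b0'; rewrite ler_pXn2r.
set y := polyrow_op T1 u F; set g := polyrow_op T1 u (d ^+ m *: (e *: F)).
have hy : `|h - y| <= t%:C.
  by rewrite /y FE subKr (le_trans _ (ltW NP)) // iter_contraction.
have gy : `|g - y| <= t%:C * `|h|.
  apply: sq; rewrite ?mulr_ge0 // exprMn.
  have -> : g - y = polyrow_op T1 u ((d ^+ m * e - 1) *: F).
    by rewrite /g /y scalerA scalerBl scale1r -[RHS](addrK y) -polyrow_opD subrK.
  apply: le_trans (polyrow_op_norm dot_norm T1_contr uP _) _.
  apply: le_trans (ler_wpM2l _ Fn); last by rewrite exprn_ge0.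
  apply: polyrow_norm2_le => w w1.
  rewrite /polyrow_eval map_mxZ dnormZ ler_wpM2r ?dnorm_ge0 //.
  rewrite ler_pXn2r //= horner_evalE hornerD hornerN hornerC.
  by apply: eP; rewrite w1.
have Bg : `|poly_op p T1 T2 g| <= s%:C * ((1 + t)%:C * `|h|).
  apply: sq; rewrite ?mulr_ge0 // exprMn.
  apply: le_trans (poly_op_transfer_bound _ pm) _; rewrite ler_wpM2l ?exprn_ge0 //.
  rewrite exprMn; apply: le_trans (ler_wpM2l _ Fn); last by rewrite exprn_ge0.
  apply: polyrow_norm2_le => w w1; rewrite scalerA.
  rewrite /polyrow_eval map_mxZ dnormZ ler_wpM2r ?dnorm_ge0 //.
  rewrite ler_pXn2r //= horner_evalE -[_.[w]](subrK 1) rmorphD addrC.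
  apply: le_trans (ler_normD _ _) _; rewrite normr1 lerD //.
  by apply: eP; rewrite w1.
have -> : poly_op p T1 T2 h = poly_op p T1 T2 g - poly_op p T1 T2 (g - y) + poly_op p T1 T2 (h - y).
  by rewrite !poly_opB opprB !subrKC.
apply: le_trans (ler_normD _ _) _; apply: le_trans (lerD (ler_normB _ _) (lexx _)) _.
apply: le_trans (lerD (lerD Bg (cP _)) (cP _)) _.
have c0' : 0 <= c%:C by rewrite ler0c.
apply: le_trans (lerD (lerD (lexx _) (ler_wpM2l c0' gy)) (ler_wpM2l c0' hy)) _.
rewrite real_complex_norm -!rmorphM -!rmorphD lecR.
have : t * (1 + a) = r by rewrite /t divfK // gt_eqF // ltr_wpDr.
rewrite /a; nra.
Qed.

End VonNeumann.

(** * The distinguished variety *)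

Section Variety.
Variable R : realType.
Implicit Types (z w : R[i]) (p q : {poly {poly R[i]}}).

Lemma horner2_continuous p : continuous (fun x : R[i] * R[i] => p.[x.1, x.2]).
Proof.
move=> [z w].
have cvg_pow (f : R[i] * R[i] -> R[i]) n (a : R[i]) :
    f x @[x --> (z, w)] --> a -> f x ^+ n @[x --> (z, w)] --> a ^+ n.
  move=> fa; elim: n => [|n IH]; first by under eq_fun do rewrite expr0; exact: cvg_cst.
  rewrite exprS; under eq_fun do rewrite exprS; exact: (cvgM fa IH).
have cvg_bigsum (n : nat) (F : 'I_n -> R[i] * R[i] -> R[i]) (l : 'I_n -> R[i]) :
    (forall i, F i x @[x --> (z, w)] --> l i) ->
    \sum_(i < n) F i x @[x --> (z, w)] --> \sum_(i < n) l i.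
  elim: n F l => [|n IH] F l Fl.
    by rewrite big_ord0; under eq_fun do rewrite big_ord0; exact: cvg_cst.
  rewrite big_ord_recr; under eq_fun do rewrite big_ord_recr.
  by apply: cvgD => //; apply: IH.
rewrite /continuous_at /= horner2_sum; under eq_fun do rewrite horner2_sum.
apply: (@cvg_bigsum _ _ _) => i; apply: (@cvg_bigsum _ _ _) => j.
apply: cvgM; last by apply: (@cvg_pow _ _ _); exact: cvg_snd.
apply: cvgM; first exact: cvg_cst.
by apply: cvg_pow; exact: cvg_fst.
Qed.

Lemma nbhs_pairP (x : R[i] * R[i]) (A : set (R[i] * R[i])) :
  nbhs x A <-> exists2 r : R, 0 < r &
    forall y, `|x.1 - y.1| < r%:C -> `|x.2 - y.2| < r%:C -> A y.
Proof.
split=> [/nbhs_ballP [e /= e0 eA]|[r r0 rA]].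
  have eE : e = (complex.Re e)%:C by rewrite RRe_real ?gtr0_real.
  exists (complex.Re e); first by rewrite -ltcR -eE.
  by move=> y y1 y2; apply: eA; split; rewrite -ball_normE /= eE.
apply/nbhs_ballP; exists r%:C; first by rewrite /= ltcR.
by move=> y []; rewrite -!ball_normE /= => y1 y2; exact: rA.
Qed.

Lemma closure_pairP (x : R[i] * R[i]) (A : set (R[i] * R[i])) :
  closure A x <-> forall r : R, 0 < r ->
    exists2 y, A y & `|x.1 - y.1| < r%:C /\ `|x.2 - y.2| < r%:C.
Proof.
split=> [clA r r0|H B /nbhs_pairP [r r0 rB]].
  have [|y [Ay yB]] := clA [set y | `|x.1 - y.1| < r%:C /\ `|x.2 - y.2| < r%:C].
    by apply/nbhs_pairP; exists r.
  by exists y.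
by have [y Ay [y1 y2]] := H _ r0; exists y; split=> //; exact: rB.
Qed.

Lemma horner2_eps p (x : R[i] * R[i]) (r : R) : 0 < r -> exists2 t : R, 0 < t &
  forall y, `|x.1 - y.1| < t%:C -> `|x.2 - y.2| < t%:C ->
    `|p.[x.1, x.2] - p.[y.1, y.2]| < r%:C.
Proof.
move=> r0; apply/nbhs_pairP; have /cvgrPdist_lt := @horner2_continuous p x.
by apply; rewrite ltcR.
Qed.

Lemma horner2_closure (A : set (R[i] * R[i])) p x :
  (forall y, A y -> p.[y.1, y.2] = 0) -> closure A x -> p.[x.1, x.2] = 0.
Proof.
move=> A0 /closure_pairP clA; apply/eqP; rewrite -normr_eq0 eq_le normr_ge0 andbT.
apply: complex_le_eps => // r r0; rewrite add0r.
have [t t0 tP] := horner2_eps p x r0; have [y Ay [y1 y2]] := clA t t0.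
by have := tP y y1 y2; rewrite (A0 y Ay) subr0 => /ltW.
Qed.

Lemma bidisc_closure x : closure (@bidisc R) x -> `|x.1| <= 1 /\ `|x.2| <= 1.
Proof.
move=> /closure_pairP clB.
have aux (a : R[i]) : (forall r : R, 0 < r -> exists2 b, `|b| < 1 & `|a - b| < r%:C) -> `|a| <= 1.
  move=> ab; apply: complex_le_eps => // r r0; have [b b1 abr] := ab r r0.
  by rewrite -[a](subrKC b) (le_trans (ler_normD _ _)) // lerD ?ltW.
by split; apply: aux => r /clB [y [y1 y2] [d1 d2]]; [exists y.1|exists y.2].
Qed.

Lemma bidisc_open : open (@bidisc R).
Proof.
rewrite openE => x [x1 x2]; apply/nbhs_pairP.
pose r := Num.min (1 - complex.Re `|x.1|) (1 - complex.Re `|x.2|).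
have R1 (a : R[i]) : (complex.Re `|a|)%:C = `|a| by rewrite RRe_real ?normr_real.
have R1B (a : R[i]) : (1 - complex.Re `|a|)%:C = 1 - `|a|.
  by rewrite rmorphB rmorph1; congr (1 - _); exact: R1.
exists r.
  by rewrite lt_min !subr_gt0 -!ltcR !R1 x1 x2.
have aux (a b : R[i]) : `|a - b| < r%:C -> r <= 1 - complex.Re `|a| -> `|b| < 1.
  move=> ab; rewrite -lecR R1B => ra.
  rewrite -(subrK a b) (le_lt_trans (ler_normD _ _)) // distrC -ltrBrDr.
  exact: lt_le_trans ab ra.
by move=> y y1 y2; split; [apply: aux y1 _|apply: aux y2 _]; rewrite ge_min lexx ?orbT.
Qed.

Variables (n1 n2 : nat) (M : 'M[R[i]]_(n1 + n2)).
Hypothesis MU : M \is unitarymx.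
Hypothesis M11_pure : forall (a : 'rV[R[i]]_n1) w, `|w| = 1 -> a *m ulsubmx M = w *: a -> a = 0.
Hypothesis M22_pure : forall (b : 'rV[R[i]]_n2) w, `|w| = 1 -> b *m drsubmx M = w *: b -> b = 0.

Definition transfer_variety : set (R[i] * R[i]) :=
  [set x | bidisc x /\ (transfer_curve M).[x.1, x.2] = 0].

(** The fibre over z = 0 is the spectrum of M11, nonempty as n1 > 0. *)
Lemma transfer_variety_neq0 : (0 < n1)%N -> transfer_variety !=set0.
Proof.
move=> n10; have [w wE] := eigenvalue_closed (transfer M 0) n10.
have z0 : `|0 : R[i]| <= 1 by rewrite normr0.
have q0 : (transfer_curve M).[0, w] = 0.
  by apply/eqP; rewrite (transfer_curve_eq0 MU M22_pure).
exists (0, w); split=> //; split; first by rewrite /= normr0.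
by apply: (transfer_curve_lt1 MU M11_pure M22_pure _ q0); rewrite normr0.
Qed.

Lemma transfer_variety_distinguished : (0 < n1)%N ->
  algebraic_distinguished_variety transfer_variety.
Proof.
move=> n10; split; first exact: transfer_variety_neq0.
  by exists (transfer_curve M).
have Vb : transfer_variety `<=` @bidisc R by move=> x [].
apply/seteqP; split=> x [clV xb]; split=> //.
  have q0 : (transfer_curve M).[x.1, x.2] = 0 by apply: horner2_closure clV => y [].
  have [x1 x2] := bidisc_closure (closure_subset Vb clV).
  have [_ xi] := xb.
  (* Otherwise |x.1| < 1 forces |x.2| < 1, and [x] would be interior to the bidisc. *)
  have z1 : `|x.1| = 1.
    apply/eqP; apply: contraT => xn; have x1' : `|x.1| < 1 by rewrite lt_neqAle xn.
    have := bidisc_open; rewrite openE => bidisc_int; case: xi; apply: bidisc_int.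
    by split=> //; exact: (transfer_curve_lt1 MU M11_pure M22_pure x1' q0).
  split=> //; apply/eqP.
  by rewrite -(transfer_curve_norm1 MU M11_pure M22_pure x1 q0) z1 eqxx.
have [x1 _] := xb; split; first exact: closure_subset clV.
by move=> /interior_subset [/=]; rewrite x1 ltxx.
Qed.

(* Roots of the characteristic polynomial of [transfer (r z)], [r < 1], tend to
   those of [transfer z] as [r] tends to 1. *)
Lemma transfer_boundary_dense z w : `|z| = 1 -> eigenvalue (transfer M z) w ->
  closure transfer_variety (z, w).
Proof.
move=> z1 zw; have z1' : `|z| <= 1 by rewrite z1.
have q0 : (transfer_curve M).[z, w] = 0.
  by apply/eqP; rewrite (transfer_curve_eq0 MU M22_pure).
apply/closure_pairP => r r0 /=.
pose d : {poly {poly R[i]}} := map_poly polyC (\det (pencil M)).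
have dE x : d.[x, w] = (\det (pencil M)).[x] by rewrite horner_map hornerC.
pose D := complex.Re `|(\det (pencil M)).[z]|.
have DE : `|(\det (pencil M)).[z]| = D%:C by rewrite RRe_real ?normr_real.
have D0 : 0 < D by rewrite -ltcR -DE normr_gt0; exact: det_pencil_neq0.
have D20 : 0 < D / 2 by rewrite divr_gt0.
have [t1 t10 t1P] := horner2_eps d (z, w) D20.
(* Near [z] the denominator stays above D / 2 in modulus; dividing by its power [n1] leaves a
   determinant below [r ^+ n1], as [eigenvalue_near_det] requires. *)
have e0 : 0 < (D / 2 * r) ^+ n1 by rewrite exprn_gt0 // mulr_gt0.
have [t2 t20 t2P] := horner2_eps (transfer_curve M) (z, w) e0.
pose t := Num.min (Num.min t1 t2) (Num.min r 1) / 2.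
have m0 : 0 < Num.min (Num.min t1 t2) (Num.min r 1) by rewrite !lt_min t10 t20 r0 ltr01.
have t0 : 0 < t by rewrite divr_gt0.
have lt_t a : Num.min (Num.min t1 t2) (Num.min r 1) <= a -> t < a.
  by move=> ma; apply: lt_le_trans ma; rewrite /t ltr_pdivrMr // ltr_pMr // ltr1n.
have tt1 : t < t1 by apply: lt_t; rewrite !ge_min lexx.
have tt2 : t < t2 by apply: lt_t; rewrite !ge_min lexx !orbT.
have tr : t < r by apply: lt_t; rewrite !ge_min lexx !orbT.
have t1' : t < 1 by apply: lt_t; rewrite !ge_min lexx !orbT.
pose x := (1 - t)%:C * z.
have zx : `|z - x| = t%:C.
  have -> : z - x = t%:C * z by rewrite /x rmorphB rmorph1; ring.
  by rewrite normrM z1 mulr1 ger0_norm // ler0c ltW.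
have x1 : `|x| < 1.
  have lt1 : (1 - t)%:C < 1 :> R[i] by rewrite -(rmorph1 (real_complex R)) ltcR; lra.
  by rewrite normrM z1 mulr1 ger0_norm // ler0c subr_ge0 ltW.
have xU : 1%:M - x *: drsubmx M \in unitmx by apply: (pencil_unit MU M22_pure); rewrite ltW.
have w0 a : 0 < a -> `|w - w| < a%:C by rewrite subrr normr0 ltcR.
have := t1P (x, w); rewrite /= zx ltcR !dE => /(_ tt1 (w0 _ t10)) dx.
have := t2P (x, w); rewrite /= zx ltcR => /(_ tt2 (w0 _ t20)).
rewrite q0 sub0r normrN (transfer_curve_eval _ xU) normrM normrX => qx.
have Dx : (D / 2)%:C <= `|(\det (pencil M)).[x]|.
  have : D%:C <= (D / 2)%:C + `|(\det (pencil M)).[x]|.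
    rewrite -DE -[X in `|X|](subrK (\det (pencil M)).[x]).
    by apply: le_trans (ler_normD _ _) _; rewrite lerD2r ltW.
  have -> : D%:C = (D / 2)%:C + (D / 2)%:C by rewrite -rmorphD -splitr.
  by rewrite lerD2l.
have detx : `|\det (transfer M x - w%:M)| < r%:C ^+ n1.
  rewrite -(@ltr_pM2l _ ((D / 2)%:C ^+ n1)); last by rewrite exprn_gt0 // ltcR.
  apply: le_lt_trans (_ : _ <= `|(\det (pencil M)).[x]| ^+ n1 * `|\det (transfer M x - w%:M)|) _.
    by rewrite ler_wpM2r // lerXn2r ?nnegrE // ler0c ltW.
  by apply: lt_le_trans qx _; rewrite -exprMn -rmorphM -rmorphXn.
have rC : 0 <= r%:C by rewrite ler0c ltW.
have [w' w'E ww'] := eigenvalue_near_det rC detx.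
have q0' : (transfer_curve M).[x, w'] = 0.
  by apply/eqP; rewrite (transfer_curve_eq0 MU M22_pure) // ltW.
exists (x, w'); last by rewrite zx ltcR.
split=> //; split=> //.
exact: (transfer_curve_lt1 MU M11_pure M22_pure x1 q0').
Qed.

Lemma transfer_boundary_bound p (s : R) : 0 <= s ->
  (forall x, transfer_variety x -> `|p.[x.1, x.2]| <= s%:C) ->
  forall z w, `|z| = 1 -> eigenvalue (transfer M z) w -> `|p.[z, w]| <= s%:C.
Proof.
move=> s0 ps z w z1 /(transfer_boundary_dense z1)/closure_pairP clV.
apply: complex_le_eps => // [|r r0]; first by rewrite ler0c.
have [t t0 tP] := horner2_eps p (z, w) r0; have [y Vy [y1 y2]] := clV t t0.
rewrite -[p.[z, w]](subrKC p.[y.1, y.2]); apply: le_trans (ler_normD _ _) _.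
by apply: lerD; [exact: ps|exact/ltW/tP].
Qed.

End Variety.

(** * From eigenvectors of the blocks to the theorem *)

Section Realization.
Variables (R : realType) (H : completeNormedModType R[i]).

Lemma sum_scale_mulmx m n (X : 'M[R[i]]_(m, n)) (x : 'I_n -> H) (b : 'rV_m) :
  \sum_j b 0 j *: (\sum_k X j k *: x k) = \sum_k (b *m X) 0 k *: x k.
Proof.
under eq_bigr do rewrite scaler_sumr.
rewrite exchange_big; apply: eq_bigr => k _ /=.
by rewrite mxE scaler_suml; apply: eq_bigr => j _; rewrite scalerA.
Qed.

Lemma eigenvector_combination (T1 T2 : {linear H -> H}) n1 n2 (A : 'M[R[i]]_n1)
    (B : 'M[R[i]]_(n1, n2)) (u : 'I_n1 -> H) (v : 'I_n2 -> H) (a : 'rV_n1) w :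
  (forall j, T2 (u j) = \sum_k A j k *: u k + T1 (\sum_k B j k *: v k)) ->
  a *m A = w *: a -> a *m B = 0 ->
  T2 (\sum_k a 0 k *: u k) = w *: \sum_k a 0 k *: u k.
Proof.
move=> uE aA aB.
rewrite linear_sum; under eq_bigr do rewrite linearZ /= uE scalerDr -linearZ.
rewrite big_split /= -linear_sum !sum_scale_mulmx aA aB scaler_sumr.
rewrite [X in T1 X]big1 ?linear0 ?addr0 => [|k _]; last by rewrite mxE scale0r.
by apply: eq_bigr => k _; rewrite mxE scalerA.
Qed.

(** For nonzero [w] the combination is an eigenvector of [T1] for 1/w, which lets purity of [T1] act
    on M22. *)
Lemma coeigenvector_combination (T1 : {linear H -> H}) n1 n2 (A : 'M[R[i]]_(n2, n1))
    (B : 'M[R[i]]_n2) (u : 'I_n1 -> H) (v : 'I_n2 -> H) (b : 'rV_n2) w :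
  (forall j, v j = \sum_k A j k *: u k + T1 (\sum_k B j k *: v k)) ->
  b *m B = w *: b -> b *m A = 0 ->
  \sum_k b 0 k *: v k = w *: T1 (\sum_k b 0 k *: v k).
Proof.
move=> vE bB bA; rewrite -linearZ -[RHS]add0r.
transitivity (\sum_j b 0 j *: (\sum_k A j k *: u k + T1 (\sum_k B j k *: v k))).
  by apply: eq_bigr => j _; rewrite -vE.
under eq_bigr do rewrite scalerDr -linearZ.
rewrite big_split /= -linear_sum !sum_scale_mulmx bB bA; congr (_ + T1 _).
  by rewrite big1 // => k _; rewrite mxE scale0r.
by rewrite scaler_sumr; apply: eq_bigr => k _; rewrite mxE scalerA.
Qed.

Lemma swap_unitary : block_mx 0 1%:M 1%:M 0 \is @unitarymx R[i] (1 + 1) (1 + 1).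
Proof.
apply/unitarymxP; rewrite tr_block_mx map_block_mx !trmx0 !trmx1 !map_mx0 !map_mx1.
by rewrite mulmx_block !mulmx0 !mul0mx !mulmx1 !addr0 !add0r -scalar_mx_block.
Qed.

(** The swap matrix has transfer function z, so this variety is the diagonal. It serves the
    degenerate case n1 = 0. *)
Lemma distinguished_variety_ex : exists V, @algebraic_distinguished_variety R V.
Proof.
exists (transfer_variety (block_mx 0 1%:M 1%:M 0 : 'M[R[i]]_(1 + 1))).
apply: transfer_variety_distinguished => //; first exact: swap_unitary.
  move=> a w w1; rewrite block_mxKul mulmx0 => /esym/eqP.
  by rewrite scaler_eq0 -normr_eq0 w1 oner_eq0 => /eqP.
move=> a w w1; rewrite block_mxKdr mulmx0 => /esym/eqP.
by rewrite scaler_eq0 -normr_eq0 w1 oner_eq0 => /eqP.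
Qed.

Lemma sup_norm_ge0 V (p : {poly {poly R[i]}}) :
  V !=set0 -> (0 <= sup_norm_on V p)%E.
Proof.
move=> [x Vx]; apply: le_trans (_ : (rnorm (p.[x.1, x.2] : R[i]))%:E <= _)%E.
  by rewrite lee_fin -ler0c -real_complex_norm.
by apply: ereal_sup_ubound; exists x.
Qed.

(** The supremum is an extended real: the infinite case is immediate, and nonemptiness of [V]
    excludes minus infinity. *)
Lemma opnorm_le_sup_norm V (p : {poly {poly R[i]}}) (A : H -> H) :
  V !=set0 ->
  (forall s : R, 0 <= s -> (forall x, V x -> `|p.[x.1, x.2]| <= s%:C) ->
     forall h, `|A h| <= s%:C * `|h|) ->
  (opnorm A <= sup_norm_on V p)%E.
Proof.
move=> V0 As; have := sup_norm_ge0 p V0.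
case E : (sup_norm_on V p) => [s| |] // s0; last by rewrite leey.
apply: ge_ereal_sup => _ [h h1 <-]; rewrite lee_fin -lecR -real_complex_norm.
have s0' : 0 <= s by rewrite -lee_fin.
apply: le_trans (As s s0' _ h) _.
  move=> x Vx; rewrite real_complex_norm lecR -lee_fin -E.
  by apply: ereal_sup_ubound; exists x.
by rewrite -[leRHS]mulr1 ler_wpM2l // ler0c.
Qed.

End Realization.

Theorem theorem6p2 (R : realType) (H : completeNormedModType R[i])
    (dot : {dot H for Num.conj}) (dot_norm : is_inner_product dot)
    (T1 T2 : {linear H -> H})
    (T12_comm : forall x : H, T1 (T2 x) = T2 (T1 x))
    (T1_pure : pure_contraction dot T1) (T2_pure : pure_contraction dot T2)
    (T1_fin : finite_dimensional (defect_space_adj dot T1))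
    (T2_fin : finite_dimensional (defect_space_adj dot T2)) :
  exists V : set (R[i] * R[i]),
    algebraic_distinguished_variety V /\
    forall p : {poly {poly R[i]}},
      (opnorm (poly_op p T1 T2) <= sup_norm_on V p)%E.
Proof.
have [T1c _] := T1_pure; have [T2c _] := T2_pure.
have [n1 [u [uP u_free]]] := defect_decomposition dot_norm T1c T1_fin.
have [n2 [v [vP v_free]]] := defect_decomposition dot_norm T2c T2_fin.
have [n10|n10] := posnP n1.
  have [V Vd] := distinguished_variety_ex R; exists V; split=> // p.
  (* Without defect vectors the adjoint of [T1] is isometric, which purity allows only on the zero
     space. *)
  have H0 (x : H) : x = 0.
    apply: inner_eps0 => r r0; have [N /(_ N (leqnn N))] := pure_adjoint_tends T1_pure x r0.
    rewrite subr0; suff -> : `|iter N (adjoint dot T1) x| = `|x| by exact: ltW.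
    apply/eqP; rewrite -(@eqrXn2 _ 2) // eq_sym -subr_eq0.
    rewrite -(bessel_telescope dot_norm T1c uP); apply/eqP.
    apply: big1 => i _; apply: big1 => k _; suff : (k < 0)%N by [].
    by rewrite -[X in (_ < X)%N]n10.
  apply: opnorm_le_sup_norm; first by case: Vd.
  by move=> s s0 _ h; rewrite [poly_op _ _ _ _]H0 normr0 mulr_ge0 // ler0c.
have [M MU [uE vE]] := structure_matrix_ex dot_norm T12_comm T1c T2c uP vP.
have M11_pure (a : 'rV[R[i]]_n1) w : `|w| = 1 -> a *m ulsubmx M = w *: a -> a = 0.
  move=> w1 aA; apply: u_free; apply: (pure_no_unimodular_eigenvector dot_norm T2_pure w1).
  (* Unitarity gives |a M11|^2 + |a M12|^2 = |a|^2, and the first term already equals |a|^2, so a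
     M12 = 0. *)
  apply: (eigenvector_combination uE aA _); apply/eqP; rewrite -(dnorm_eq0 (@dotmx R[i] n2)).
  have := unitary_block_dot MU a a 0 0; rewrite !mul0mx !addr0 aA dnormZ w1 expr1n mul1r.
  by rewrite linear0l => /addrI/eqP.
have M22_pure (b : 'rV[R[i]]_n2) w : `|w| = 1 -> b *m drsubmx M = w *: b -> b = 0.
  move=> w1 bD; apply: v_free; have w0 : w != 0 by rewrite -normr_eq0 w1 oner_eq0.
  have w1' : `|w^-1| = 1 by rewrite normfV w1 invr1.
  apply: (pure_no_unimodular_eigenvector dot_norm T1_pure w1').
  rewrite {2}(coeigenvector_combination vE bD _) ?scalerA ?mulVf ?scale1r //.
  apply/eqP; rewrite -(dnorm_eq0 (@dotmx R[i] n1)).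
  have := unitary_block_dot MU 0 0 b b; rewrite !mul0mx !add0r bD dnormZ w1 expr1n mul1r.
  by rewrite linear0l => /addIr/eqP.
have Vd := transfer_variety_distinguished MU M11_pure M22_pure n10.
exists (transfer_variety M); split=> // p.
apply: opnorm_le_sup_norm; first by case: Vd.
move=> s s0 ps h.
apply: (poly_op_bound dot_norm T12_comm T1_pure T2c uP uE vE MU M22_pure s0).
exact: transfer_boundary_bound.
Qed.
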